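(* (In ZFC.) For each cardinal $\kappa$ with $1\le\kappa\leq\omega_1$, there exists a group topology on the Boolean group $G$ of cardinality $\mathfrak c$ such that $G^\gamma$ is countably compact for each cardinal $\gamma<\kappa$ and $G^\kappa$ is not countably compact.
   Context: All group topologies are Hausdorff, and powers carry the product topology. $\mathfrak c=2^{\aleph_0}$. A Boolean group is a group in which every element $g$ satisfies $g+g=0$; the Boolean group of cardinality $\mathfrak c$ is, up to isomorphism, the direct sum of $\mathfrak c$ copies of $\mathbb Z/2\mathbb Z$. Cardinals $\gamma,\kappa$ may be finite. A space is countably compact if every sequence in it has an accumulation point, where $x$ is an accumulation point of $(x_n)_{n\in\omega}$ if every neighbourhood of $x$ contains $x_n$ for infinitely many $n$. *)

(* Defs.v *)
From HB Require Import structures.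
From mathcomp Require Import all_boot all_order all_algebra.
From mathcomp Require Import all_classical all_reals all_analysis wochoice.
Set Implicit Arguments.
Unset Strict Implicit.
Unset Printing Implicit Defensive.
Import GRing.Theory.
Local Open Scope classical_set_scope.
Local Open Scope card_scope.
Local Open Scope ring_scope.

(* A cardinal is represented by a type having that cardinality (possibly empty
   or finite). *)
Definition card_lt (T U : Type) : Prop :=
  [set: T] #<= [set: U] /\ ~ ([set: U] #<= [set: T]).

(* The indices are counted, not the values: a sequence taking the value [x]
   infinitely often accumulates at [x]. *)
Definition accumulation_point (X : topologicalType) (u : nat -> X) (x : X) :
    Prop :=
  forall U : set X, nbhs x U -> infinite_set [set n | U (u n)].

Definition countably_compact (X : topologicalType) : Prop :=
  forall u : nat -> X, exists x : X, accumulation_point u x.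

Definition boolean_group (G : zmodType) : Prop := forall g : G, g + g = 0.

(* The first uncountable ordinal, realized inside a well-ordering of
   [nat -> bool] as the set of points having only countably many predecessors;
   see [omega1P]. *)
Definition cantor_le : rel (nat -> bool) :=
  sval (well_ordering_principle (nat -> bool)).

Definition omega1 : Type :=
  {x : nat -> bool | countable [set y | cantor_le y x]}.

Definition omega1_le : rel omega1 := fun v w => cantor_le (sval v) (sval w).

Lemma omega1_val_inj : injective (sval : omega1 -> nat -> bool).
Proof. by move=> [x px] [y py] /= xy; exact: eq_exist. Qed.

Lemma cantor_le_wo : well_order cantor_le.
Proof. exact: (svalP (well_ordering_principle (nat -> bool))). Qed.

Lemma cantor_le_chain : wo_chain cantor_le predT.
Proof. by move=> A _; exact: cantor_le_wo. Qed.

Lemma cantor_le_total x y : cantor_le x y || cantor_le y x.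
Proof. exact: (wo_chainW cantor_le_chain). Qed.

Lemma cantor_le_anti x y : cantor_le x y -> cantor_le y x -> x = y.
Proof.
by move=> xy yx; apply: (wo_chain_antisymmetric cantor_le_chain) => //; apply/andP.
Qed.

Lemma cantor_le_trans x y z : cantor_le x y -> cantor_le y z -> cantor_le x z.
Proof.
move=> xy yz.
pose A : {pred nat -> bool} := fun t => `[< t = x \/ t = y \/ t = z >].
have [|m [[/asboolP Am mA] _]] := @cantor_le_wo A.
  by exists x; apply/asboolP; left.
have mx : cantor_le m x by apply: mA; apply/asboolP; left.
have my : cantor_le m y by apply: mA; apply/asboolP; right; left.
have mz : cantor_le m z by apply: mA; apply/asboolP; right; right.
case: Am => [<-//|[Em|Em]]; rewrite Em in mx my.
- by rewrite (cantor_le_anti xy mx).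
- by rewrite -(cantor_le_anti yz my).
Qed.

Lemma uncountable_cantor : ~ countable [set: nat -> bool].
Proof.
move=> /countable_injP[f finj].
pose d n := ~~ `[< exists2 g : nat -> bool, f g = n & g n >].
have [dfd|dfd] := boolP (d (f d)).
  have := dfd; rewrite /d => /asboolPn; apply; exists d => //.
have := dfd; rewrite {1}/d negbK => /asboolP[g fg gn].
have Eg : g = d by apply: finj fg; rewrite inE.
by move: dfd; rewrite -{1}Eg gn.
Qed.

Lemma omega1P :
  [/\ well_order omega1_le, ~ countable [set: omega1] &
      forall v : omega1, countable [set w | omega1_le w v]].
Proof.
split.
- move=> A [a Aa].
  pose B : {pred nat -> bool} := fun x => `[< exists2 v, v \in A & sval v = x >].
  have [|m [[/asboolP[v Av <-] vB] _]] := @cantor_le_wo B.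
    by exists (sval a); apply/asboolP; exists a.
  have vA : forall w, w \in A -> omega1_le v w.
    by move=> w Aw; apply: vB; apply/asboolP; exists w.
  exists v; split=> [//|w [Aw wA]].
  by apply: omega1_val_inj; apply: cantor_le_anti; [exact: vA|exact: wA].
- move=> cW.
  pose S : set (nat -> bool) := [set x | countable [set y | cantor_le y x]].
  have cS : countable S.
    have -> : S = sval @` [set: omega1].
      by apply/seteqP; split=> [x Sx|_ [v _ <-]]; [exists (exist _ x Sx)|exact: svalP].
    by apply: sub_countable cW; exact: card_image_le.
  pose B : {pred nat -> bool} := fun x => `[< ~ S x >].
  have [|m [[/asboolP mS mB] _]] := @cantor_le_wo B.
    apply: contrapT => SB; apply: uncountable_cantor.
    apply: sub_countable cS; apply: subset_card_le => x _.
    by apply: contrapT => Sx; apply: SB; exists x; apply/asboolP.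
  apply: mS; rewrite /S /=.
  have Sy y : cantor_le y m -> y <> m -> S y.
    move=> ym yDm; apply: contrapT => nSy; apply: yDm.
    by apply: cantor_le_anti => //; apply: mB; apply/asboolP.
  have /countable_injP[f finj] := cS.
  apply/countable_injP; exists (fun y => if `[< y = m >] then 0%N else (f y).+1).
  move=> x y /set_mem /= xm /set_mem /= ym.
  have [->|xDm] := pselect (x = m); have [->|yDm] := pselect (y = m) => //.
  - by rewrite asboolT // asboolF.
  - by rewrite asboolF // asboolT.
  - by rewrite !asboolF // => -[]; apply: finj; rewrite inE; exact: Sy.
- move=> v; have /countable_injP[f finj] := svalP v.
  apply/countable_injP; exists (f \o sval) => w1 w2 /set_mem w1v /set_mem w2v fw.
  by apply: omega1_val_inj; apply: finj fw; rewrite inE.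
Qed.

(* Main.v *)
Require Import Defs.
From HB Require Import structures.
From mathcomp Require Import all_boot all_order all_algebra.
From mathcomp Require Import all_classical all_reals all_analysis wochoice.

(* Take a basis of G consisting of base sequences g_i (i in K), the elements
   [Base i k], and of formal limits [Lim] of tuples of sequences; a tuple is
   indexed by a set of cardinality less than K, and its terms are linearly
   independent within each block of an index set.  The topology is induced by
   the characters which send the formal limits of every tuple T to the limits
   along an ultrafilter p_T.  Modulo sequences that are constant along an
   ultrafilter, a sequence in a power G^I with |I| < |K| reduces to such a
   tuple, and therefore accumulates.

   Each p_T contains the sets that miss few indices of each block of T, where
   blocks are numbered by an almost disjoint family.  The blocks grow so fast
   that, block after block, all but few of the linear equations imposed by
   countably many tuples can be satisfied by counting dimensions.  This gives
   enough characters to separate points, and characters with arbitrary values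
   along one additional tuple.

   The p_T are chosen one at a time so that, if some nontrivial combination of
   the g_i already has a limit along q, then no new combination acquires one.
   Hence all limits along q come from a single tuple indexed by J, and the
   combinations having one embed in a vector space of dimension |J| < |K|: the
   g_i do not converge simultaneously, and G^K is not countably compact. *)

Set Implicit Arguments.
Unset Strict Implicit.
Unset Printing Implicit Defensive.
Import GRing.Theory.
Local Open Scope classical_set_scope.
Local Open Scope ring_scope.

(** * Characters of Boolean groups *)

Lemma Zorn_above T (P : set (set T)) (A0 : set T) :
  P A0 ->
  (forall F : set (set T), F !=set0 -> F `<=` P -> total_on F subset ->
    P (\bigcup_(X in F) X)) ->
  exists A, [/\ P A, A0 `<=` A & forall B, P B -> A `<=` B -> B `<=` A].
Proof.
(* The union of the empty chain is empty, so [Q] must admit the empty set beside the sets that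
   contain [A0]. *)
move=> PA0 chP; pose Q S := S = set0 \/ (P S /\ A0 `<=` S).
have [F FQ Ftot|A [QA Amax]] := @Zorn_bigcup T Q.
  have [[X [FX X0]]|allE] := pselect (exists X, F X /\ X <> set0); last first.
    left; rewrite -subset0 => x [X FX Xx].
    by apply: allE; exists X; split=> // XE; rewrite XE in Xx.
  right; pose F' := F `&` [set X | X <> set0].
  have F'E : \bigcup_(X in F) X = \bigcup_(X in F') X.
    apply/seteqP; split=> [x [Y FY Yx]|x [Y [FY _] Yx]]; exists Y => //.
    by split=> // YE; rewrite YE in Yx.
  have F'P Y : F' Y -> P Y /\ A0 `<=` Y by case=> /FQ [].
  rewrite F'E; split.
    apply: chP; first by exists X.
      by move=> Y /F'P[].
    by move=> Y Z [FY _] [FZ _]; exact: Ftot.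
  by move=> x A0x; exists X => //; have [_] := F'P X (conj FX X0); apply.
have [A00|A0n] := pselect (A0 = set0).
  have PA : P A by case: QA => [->|[//]]; move: PA0; rewrite A00.
  exists A; split=> //; first by rewrite A00.
  move=> B PB AB; apply: contrapT => nBA.
  by apply: (Amax B); [split|right; split=> //; rewrite A00].
have [PA A0A] : P A /\ A0 `<=` A.
  case: QA => // A_0; exfalso; apply: (Amax A0); last by right; split.
  rewrite A_0; split; first exact: sub0set.
  by rewrite subset0.
exists A; split=> // B PB AB; apply: contrapT => nBA.
by apply: (Amax B); [split|right; split=> //; exact: subset_trans AB].
Qed.

Section BooleanGroup.
Variables (G : zmodType) (G2 : forall g : G, g + g = 0).
Implicit Types (x y : G) (E : seq G).

Lemma bool_addKr x y : x + (x + y) = y.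
Proof. by rewrite addrA G2 add0r. Qed.

Lemma addr_same e x y : x + y = (x + e) + (y + e).
Proof. by rewrite addrACA G2 addr0. Qed.

Lemma mulrb_addb x (a b : bool) : x *+ (a (+) b) = x *+ a + x *+ b.
Proof. by case: a b => [] []; rewrite /= ?mulr1n ?mulr0n ?G2 ?addr0 ?add0r. Qed.

Lemma addr_eq0_bool x y : x + y = 0 -> x = y.
Proof. by move=> xy0; rewrite -[y]add0r -xy0 -addrA G2 addr0. Qed.

Definition character (chi : G -> bool) := {morph chi : x y / x + y >-> x (+) y}.

Lemma character0 chi : character chi -> chi 0 = false.
Proof. by move=> chiD; have := chiD 0 0; rewrite addr0 addbb. Qed.

Lemma character_sum chi (I : Type) (r : seq I) (P : pred I) (F : I -> G) :
  character chi ->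
  chi (\sum_(i <- r | P i) F i) = \big[addb/false]_(i <- r | P i) chi (F i).
Proof. by move=> chiD; apply: big_morph => //; exact: character0. Qed.

Lemma characterMn chi x (b : bool) : character chi -> chi (x *+ b) = chi x && b.
Proof.
by move=> chiD; case: b; rewrite ?mulr1n ?mulr0n ?andbT ?andbF // character0.
Qed.

Fixpoint span E : set G :=
  if E is e :: E' then [set x | span E' x \/ span E' (x + e)] else [set 0].

Lemma span0 E : span E 0.
Proof. by elim: E => //= e E IH; left. Qed.

Lemma spanD E x y : span E x -> span E y -> span E (x + y).
Proof.
elim: E x y => [x y -> ->|e E IH x y /= [Ex|Ex] [Ey|Ey]]; first exact: addr0.
- by left; apply: IH.
- by right; rewrite -addrA; apply: IH.
- by right; rewrite addrAC; apply: IH.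
- by left; rewrite (addr_same e); apply: IH.
Qed.

Lemma span_cons E e x : span E x -> span (e :: E) x.
Proof. by left. Qed.

Lemma span_mem E x : x \in E -> span E x.
Proof.
elim: E => // e E IH; rewrite inE => /predU1P[->|/IH]; last by left.
by right; rewrite G2; exact: span0.
Qed.

Lemma span_catr E1 E2 x : span E2 x -> span (E1 ++ E2) x.
Proof. by elim: E1 => //= e E1 IH Ex; left; exact: IH. Qed.

Lemma span_sum (I : Type) (r : seq I) (P : pred I) (F : I -> G) E :
  (forall i, P i -> span E (F i)) -> span E (\sum_(i <- r | P i) F i).
Proof.
move=> EF; elim/big_rec : _ => [|i x Pi Ex]; first exact: span0.
by apply: spanD => //; exact: EF.
Qed.

Lemma span_map_cat (I : finType) (w : I -> G) (r : seq I) E x :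
  span ([seq w i | i <- r] ++ E) x ->
  exists2 c : I -> bool, (forall i, c i -> i \in r) &
    span E (x + \sum_i w i *+ c i).
Proof.
elim: r x => [x Ex|i r IH x /= [/IH|/IH]].
- by exists xpred0 => //; rewrite big1 ?addr0.
- by move=> [c cr Ec]; exists c => // k /cr kr; rewrite inE kr orbT.
- move=> [c cr Ec]; exists (fun k => (k == i) (+) c k).
    by move=> k; rewrite inE; case: eqP => //= _; exact: cr.
  rewrite (eq_bigr (fun k => w k *+ (k == i) + w k *+ c k)); last first.
    by move=> k _; rewrite mulrb_addb.
  rewrite big_split /= (bigD1 i) //= eqxx mulr1n big1 ?addr0 ?addrA //.
  by move=> k /negbTE ->.
Qed.

(** A subgroup [S] maximal among those containing [R] and missing [x0] has index two: enlarging it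
    by any [x] outside captures [x0], so [x] lies in the coset of [x0]. The indicator of the
    complement is then a character. *)
Lemma separating_character (R : set G) (x0 : G) :
  R 0 -> (forall x y, R x -> R y -> R (x + y)) -> ~ R x0 ->
  exists chi, [/\ character chi, chi x0 & forall x, R x -> chi x = false].
Proof.
move=> R0 RD Rx0.
pose P S := [/\ S 0, (forall x y, S x -> S y -> S (x + y)) & ~ S x0].
have [//|F [X FX] FP Ftot|S [[S0 SD Sx0] RS Smax]] := @Zorn_above _ P R.
  split.
  - by exists X => //; have [] := FP _ FX.
  - move=> x y [Y FY Yx] [Z FZ Zy].
    have [YZ|ZY] := Ftot _ _ FY FZ.
      by exists Z => //; have [_ ZD _] := FP _ FZ; apply: ZD => //; exact: YZ.
    by exists Y => //; have [_ YD _] := FP _ FY; apply: YD => //; exact: ZY.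
  - by move=> [Y FY Yx0]; have [] := FP _ FY.
have Smax' x : ~ S x -> S (x0 + x).
  move=> Sx; apply: contrapT => Sx0x; apply: Sx.
  apply: (Smax [set y | S y \/ S (y + x)]).
  - split; first by left.
      move=> y z [Sy|Sy] [Sz|Sz].
      + by left; exact: SD.
      + by right; rewrite -addrA; exact: SD.
      + by right; rewrite addrAC; exact: SD.
      + by left; rewrite (addr_same x); exact: SD.
    by case.
  - by move=> y Sy; left.
  - by right; rewrite G2.
exists (fun x => ~~ `[< S x >]); split.
- move=> x y; case: (asboolP (S x)) => Sx; case: (asboolP (S y)) => Sy /=.
  + by rewrite asboolT //; exact: SD.
  + by rewrite asboolF // => Sxy; apply: Sy; rewrite -(bool_addKr x y); exact: SD.
  + rewrite asboolF // => Sxy; apply: Sx.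
    by rewrite -(bool_addKr y x) [y + x]addrC; exact: SD.
  + rewrite asboolT // (addr_same x0) ![_ + x0]addrC.
    by apply: SD; exact: Smax'.
- by rewrite asboolF.
- by move=> x /RS Sx; rewrite asboolT.
Qed.

(* Each generator of [span E] spoils at most one index [l]. *)
Lemma avoid_columns (n s : nat) (J : pred 'I_n) (v : 'I_n * 'I_s -> G) E :
  (forall c : 'I_n * 'I_s -> bool, (forall i, c i -> J i.1) ->
    \sum_i v i *+ c i = 0 -> forall i, c i = false) ->
  exists2 L : {set 'I_s}, (#|L| <= size E)%N &
    forall c : 'I_n * 'I_s -> bool,
      (forall i, c i -> J i.1 && (i.2 \notin L)) ->
      span E (\sum_i v i *+ c i) -> forall i, c i = false.
Proof.
move=> vfree; elim: E => [|e E [L Ls LE]].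
  exists finset.set0; rewrite ?cards0 // => c cJ /=.
  by apply: vfree => i /cJ /andP[].
have [[c0 [c0J Ec0 [i0 c0i0]]]|noc] := pselect (exists c0 : 'I_n * 'I_s -> bool,
    [/\ forall i, c0 i -> J i.1 && (i.2 \notin L),
      span E (\sum_i v i *+ c0 i + e) & exists i, c0 i]).
  (* Deleting one column used by [c0] suffices: a second such combination [c], added to [c0], would
     lie in [span E] and hence vanish, although only [c0] is nonzero at [i0]. *)
  exists (i0.2 |: L).
    by rewrite (leq_trans (leq_card_setU _ _)) // cards1.
  have sub c : (forall i, c i -> J i.1 && (i.2 \notin i0.2 |: L)) ->
      forall i, c i -> J i.1 && (i.2 \notin L).
    move=> cJ i /cJ /andP[-> /=]; apply: contra; rewrite finset.in_setU1 => ->.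
    by rewrite orbT.
  move=> c cJ [Ec|Ec]; first by apply: LE => //; exact: (sub _ cJ).
  have /(_ i0) : forall i, c i (+) c0 i = false.
    apply: LE => [i|].
      by case: (boolP (c0 i)) => [/c0J //|_]; rewrite addbF; exact: (sub _ cJ).
    rewrite (eq_bigr (fun k => v k *+ c k + v k *+ c0 k)); last first.
      by move=> k _; rewrite mulrb_addb.
    by rewrite big_split /= (addr_same e); exact: spanD.
  rewrite c0i0 addbT => /negbFE /cJ /andP[_].
  by rewrite finset.in_setU1 eqxx.
exists L; first exact: leqW.
move=> c cJ [|Ec]; first exact: LE.
move=> i; apply/negbTE/negP => ci; apply: noc; exists c; split=> //.
by exists i.
Qed.

End BooleanGroup.

(* [ngen N] bounds the number of linear conditions imposed before the [N]-th
   block and [waste N] the number of indices which they can spoil in it; the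
   factor [N.+1] in [width N] makes [block_filter] below proper. *)
Fixpoint ngen N : nat :=
  if N is M.+1 then (ngen M + M.+1 * (M.+1 * (ngen M + M.+2)).+1)%N else 0%N.

Definition waste N : nat := (ngen N + N.+2)%N.

Definition width N : nat := (N.+1 * waste N).+1.

Definition block_free (G : zmodType) N (J : pred nat) (v : nat -> nat -> G) :=
  forall c : 'I_N.+1 * 'I_(width N) -> bool, (forall i, c i -> J i.1) ->
    \sum_(i : 'I_N.+1 * 'I_(width N)) v i.1 i.2 *+ c i = 0 ->
    forall i, c i = false.

Section BlockCharacter.
Variables (G : zmodType) (G2 : forall g : G, g + g = 0) (x0 : G).
Variables (J : nat -> pred nat) (v : nat -> nat -> nat -> G).
Variables (t : nat -> nat -> G) (beta : nat -> nat -> nat -> bool).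
Hypothesis vfree : forall N, block_free N (J N) (v N).

(** A character that kills [v N j l + t N j *+ beta N j l] satisfies the equation wanted at
    [(j, l)], so these elements are added for [l] outside [L]. There the [v N j l] are independent
    modulo [x0], the [t N j] and [E], at most [waste N] generators in all, so [x0] stays outside the
    span. *)
Lemma block_step N (E : seq G) : (size E <= ngen N)%N -> ~ span E x0 ->
  exists E' : seq G, [/\ (size E' <= ngen N.+1)%N, ~ span E' x0,
    span E `<=` span E' &
    exists2 L : {set 'I_(width N)}, (#|L| <= waste N)%N &
      forall (j : nat) (l : 'I_(width N)), (j <= N)%N -> J N j -> l \notin L ->
        span E' (v N j l + t N j *+ beta N j l)].
Proof.
move=> sE Ex0.
pose P := x0 :: [seq t N (i : 'I_N.+1) | i <- enum 'I_N.+1] ++ E.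
have [L Ls LP] := avoid_columns G2 (J := fun j => J N j) P (vfree (N := N)).
pose w (i : 'I_N.+1 * 'I_(width N)) := v N i.1 i.2 + t N i.1 *+ beta N i.1 i.2.
pose q (i : 'I_N.+1 * 'I_(width N)) := J N i.1 && (i.2 \notin L).
pose r := [seq i <- enum {: 'I_N.+1 * 'I_(width N)} | q i].
have rP i : i \in r = J N i.1 && (i.2 \notin L).
  by rewrite mem_filter mem_enum andbT.
exists ([seq w i | i <- r] ++ E); split.
- rewrite size_cat size_map addnC leq_add //.
  rewrite size_filter (leq_trans (count_size _ _)) // -cardE.
  by rewrite card_prod !card_ord.
- move=> /(span_map_cat G2)[c cr Ec].
  have c0 : forall i, c i = false.
    apply: LP => [i /cr|]; first by rewrite rP.
    pose u := \sum_(i : 'I_N.+1 * 'I_(width N)) (t N i.1 *+ beta N i.1 i.2) *+ c i.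
    have Ev : \sum_(i : 'I_N.+1 * 'I_(width N)) v N i.1 i.2 *+ c i =
        (x0 + \sum_i w i *+ c i) + (x0 + u).
      rewrite addrACA G2 add0r /u -big_split /=; apply: eq_bigr => i _.
      by rewrite /w mulrnDl -addrA -mulrnDl G2 mul0rn addr0.
    rewrite Ev; apply: (spanD G2); first by apply: span_cons; exact: span_catr.
    apply: (spanD G2); first by apply: (span_mem G2); rewrite inE eqxx.
    apply: (span_sum G2) => i _; case: (c i); last exact: span0.
    case: (beta _ _ _); last exact: span0.
    apply: (span_mem G2); rewrite inE mem_cat.
    by rewrite (map_f (fun j : 'I_N.+1 => t N j)) ?orbT // mem_enum.
  apply: Ex0; rewrite big1 ?addr0 // in Ec => i _; by rewrite c0.
- by move=> x; exact: span_catr.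
- exists L.
    rewrite (leq_trans Ls) // /P /= size_cat size_map size_enum_ord /waste.
    by rewrite [(ngen N + _)%N]addnC -addSn leq_add2l.
  move=> j l jN Jj lL; have jN1 : (j < N.+1)%N by [].
  have : w (Ordinal jN1, l) \in [seq w i | i <- r] ++ E.
    by rewrite mem_cat map_f // rP /= Jj.
  by move=> /(span_mem G2).
Qed.

Hypothesis x0_neq0 : x0 <> 0.

(** Iterating [block_step] gives increasing spans that miss [x0]; a character separating [x0] from
    their union meets the conditions of all blocks at once. *)
Lemma block_character : exists chi : G -> bool, [/\ character chi, chi x0 &
  forall N, exists2 L : {set 'I_(width N)}, (#|L| <= waste N)%N &
    forall (j : nat) (l : 'I_(width N)), (j <= N)%N -> J N j -> l \notin L ->
      chi (v N j l) = chi (t N j) && beta N j l].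
Proof.
pose ok N (E : seq G) := (size E <= ngen N)%N /\ ~ span E x0.
pose T := {NE : nat * seq G | ok NE.1 NE.2}.
have ok0 : ok 0%N [::] by [].
have /choice[next nextP] (p : T) : exists q : T,
    [/\ (sval q).1 = (sval p).1.+1, span (sval p).2 `<=` span (sval q).2 &
    exists2 L : {set 'I_(width (sval p).1)}, (#|L| <= waste (sval p).1)%N &
      forall (j : nat) (l : 'I_(width (sval p).1)), (j <= (sval p).1)%N ->
        J (sval p).1 j -> l \notin L ->
        span (sval q).2 (v (sval p).1 j l + t (sval p).1 j *+ beta (sval p).1 j l)].
  case: p => -[N E] /= [sE Ex0].
  have [E' [sE' E'x0 EE' [L Ls LE]]] := block_step sE Ex0.
  have okE' : ok N.+1 E' by [].
  exists (exist (fun NE : nat * seq G => ok NE.1 NE.2) (N.+1, E') okE') => /=.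
  by split=> //; exists L.
pose p0 : T := exist (fun NE : nat * seq G => ok NE.1 NE.2) (0%N, [::]) ok0.
pose seqp n := iter n next p0.
have seqp1 n : (sval (seqp n)).1 = n.
  by elim: n => //= n IH; have [-> _ _] := nextP (seqp n); rewrite IH.
pose E n := (sval (seqp n)).2.
have Emono m n : (m <= n)%N -> span (E m) `<=` span (E n).
  elim: n => [|n IH]; first by rewrite leqn0 => /eqP ->.
  rewrite leq_eqVlt => /predU1P[->//|/IH mn x /mn].
  by have [_ + _] := nextP (seqp n); apply.
have [|x y [m _ Ex] [n _ Ey]||chi [chiD chix0 chiE]] :=
    @separating_character _ G2 (\bigcup_n span (E n)) x0.
- by exists 0%N => //; exact: span0.
- exists (maxn m n) => //; apply: (spanD G2).
    by apply: Emono Ex; rewrite leq_maxl.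
  by apply: Emono Ey; rewrite leq_maxr.
- by move=> [n _]; have [_] := svalP (seqp n).
exists chi; split=> // N.
have [_ _] := nextP (seqp N); rewrite seqp1 => -[L Ls LE].
exists L => // j l jN Jj lL.
have /chiE : (\bigcup_n span (E n)) (v N j l + t N j *+ beta N j l).
  by exists N.+1 => //; exact: LE.
by rewrite chiD characterMn //; case: (chi _) => //= /negbFE.
Qed.

End BlockCharacter.

(** * Cardinality and bases *)

Lemma chain_all (T : eqType) U (F : set (set U)) (Q : set U -> T -> Prop)
    (s : seq T) :
  F !=set0 -> total_on F subset ->
  (forall X Y x, X `<=` Y -> Q X x -> Q Y x) ->
  (forall x, x \in s -> exists2 X, F X & Q X x) ->
  exists2 X, F X & forall x, x \in s -> Q X x.
Proof.
move=> F0 Ftot Qmono; elim: s => [_|x s IH sF].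
  by have [X FX] := F0; exists X.
have [|X FX sX] := IH; first by move=> y ys; apply: sF; rewrite inE ys orbT.
have [|Y FY xY] := sF x; first by rewrite inE eqxx.
have [XY|YX] := Ftot _ _ FX FY.
  exists Y => // y; rewrite inE => /predU1P[->//|/sX]; exact: Qmono.
by exists X => // y; rewrite inE => /predU1P[->|/sX //]; exact: Qmono YX _.
Qed.

Lemma card_le_setTP T U :
  ([set: T] #<= [set: U])%card <-> exists f : T -> U, injective f.
Proof.
split=> [/card_leP[f]|[f finj]]; last first.
  have fi : {in [set: T] &, injective f} by move=> x y _ _; exact: finj.
  apply: (@card_le_trans _ _ _ (f @` [set: T])); last exact: card_leT.
  by have /card_eqPle[] := inj_card_eq fi.
pose i (x : T) : [set: T] := SigSub (in_setT x).
exists (fun x => val (f (i x))) => x y /val_inj fxy.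
have /(congr1 val) // : i x = i y.
by apply: (@inj _ _ _ f); rewrite ?inE.
Qed.

Lemma sval_inj T (P : T -> Prop) : injective (fun x : {x | P x} => sval x).
Proof. by move=> [x Px] [y Py] /= xy; exact: eq_exist. Qed.

(** A maximal partial injection from [A] to [B] is defined everywhere or onto, since otherwise one
    more pair could be added. *)
Lemma inj_total (A B : Type) :
  (exists f : A -> B, injective f) \/ (exists f : B -> A, injective f).
Proof.
pose P (R : set (A * B)) :=
  (forall a b b', R (a, b) -> R (a, b') -> b = b') /\
  (forall a a' b, R (a, b) -> R (a', b) -> a = a').
have [F FP Ftot|R [[Rfun Rinj] Rmax]] := @Zorn_bigcup _ P.
  split=> [a b b' [X FX X1] [Y FY Y1]|a a' b [X FX X1] [Y FY Y1]].
    have [XY|YX] := Ftot _ _ FX FY.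
      by have [+ _] := FP _ FY; apply; [exact: XY X1|].
    by have [+ _] := FP _ FX; apply; [exact: X1|exact: YX].
  have [XY|YX] := Ftot _ _ FX FY.
    by have [_] := FP _ FY; apply; [exact: XY X1|].
  by have [_] := FP _ FX; apply; [exact: X1|exact: YX].
have [/choice[f Rf]|] := pselect (forall a, exists b, R (a, b)).
  by left; exists f => a a' faa'; apply: (Rinj _ _ (f a)) => //; rewrite faa'.
move=> /existsNP[a0 /forallNP Ra0]; right.
suff /choice[f Rf] : forall b, exists a, R (a, b).
  by exists f => b b' fbb'; apply: (Rfun (f b)) => //; rewrite fbb'.
move=> b0; apply: contrapT => /forallNP Rb0.
apply: (Rmax (R `|` [set (a0, b0)])).
  split; first by move=> x Rx; left.
  by move=> /(_ (a0, b0)) R0; apply: (Ra0 b0); apply: R0; right.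
split=> [a b b' [R1|[-> ->]] [R2|[]]|a a' b [R1|[-> ->]] [R2|[]]] //.
- exact: Rfun R1 R2.
- by move=> aE _; rewrite aE in R1; case: (Ra0 _ R1).
- by move: R2 => /Ra0.
- exact: Rinj R1 R2.
- by move=> _ bE; rewrite bE in R1; case: (Rb0 _ R1).
- by move: R2 => /Rb0.
Qed.

(* Hessenberg's theorem.  Take a maximal injection [seq A -> A] with [A]
   infinite: if the complement of [A] did not embed in [A], it would contain a
   copy of [A], over which the injection could be extended. *)
Lemma seq_inj (T : choiceType) (j : nat -> T) : injective j ->
  exists f : seq T -> T, injective f.
Proof.
move=> jinj.
pose carrier (R : set (seq T * T)) a := exists x, R ([:: a], x).
(* [R] is the graph of an injection of the lists over its carrier into that carrier, the carrier
   being read off from singleton lists. *)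
pose P (R : set (seq T * T)) :=
  [/\ forall s x y, R (s, x) -> R (s, y) -> x = y,
      forall s t x, R (s, x) -> R (t, x) -> s = t,
      forall s, (exists x, R (s, x)) <-> {in s, forall a, carrier R a} &
      forall s x, R (s, x) -> carrier R x].
pose R0 : set (seq T * T) := [set p | exists2 s : seq nat,
  p.1 = map j s & p.2 = j (pickle s)].
have R0j n : carrier R0 (j n) by exists (j (pickle [:: n])), [:: n].
have PR0 : P R0.
  split.
  - move=> _ _ _ [s /= -> ->] [t /= st ->].
    by rewrite (inj_map jinj st).
  - move=> _ _ _ [s /= -> ->] [t /= -> /jinj st].
    by rewrite (pcan_inj pickleK st).
  - move=> s; split=> [[x [t /= -> _]] _ /mapP[n _ ->] //|sR].
    have [t ->] : exists t, s = map j t.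
      elim: s sR => [_|a s IH sR]; first by exists [::].
      have [|t ->] := IH; first by move=> b bs; apply: sR; rewrite inE bs orbT.
      have [|x [[|n [|? ?]] //= [->] _]] := sR a; first by rewrite inE eqxx.
      by exists (n :: t).
    by exists (j (pickle t)), t.
  - by move=> s x [t _ /= ->].
have carrier_mono X Y a : X `<=` Y -> carrier X a -> carrier Y a.
  by move=> XY [x Xx]; exists x; exact: XY.
have [//|F F0 FP Ftot|R [[Rfun Rinj Rdom Rran] R0R Rmax]] :=
    @Zorn_above _ P R0.
  split.
  - move=> s x y [X FX X1] [Y FY Y1].
    have [XY|YX] := Ftot _ _ FX FY.
      by have [+ _ _ _] := FP _ FY; apply; [exact: XY X1|].
    by have [+ _ _ _] := FP _ FX; apply; [exact: X1|exact: YX].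
  - move=> s t x [X FX X1] [Y FY Y1].
    have [XY|YX] := Ftot _ _ FX FY.
      by have [_ + _ _] := FP _ FY; apply; [exact: XY X1|].
    by have [_ + _ _] := FP _ FX; apply; [exact: X1|exact: YX].
  - move=> s; split=> [[x [X FX Xs]] a sa|sR].
      have [_ _ + _] := FP _ FX; move=> /(_ s)[+ _].
      move=> /(_ (ex_intro _ x Xs) a sa).
      by apply: carrier_mono => p Xp; exists X.
    have [|a /sR[x [X FX Xax]]|X FX sX] :=
        @chain_all T _ F carrier s F0 Ftot; first exact: carrier_mono.
      by exists X => //; exists x.
    have [_ _ + _] := FP _ FX; move=> /(_ s)[_ /(_ sX)[x Xsx]].
    by exists x, X.
  - move=> s x [X FX Xs]; have [_ _ _ Xran] := FP _ FX.
    by apply: carrier_mono (Xran _ _ Xs) => p Xp; exists X.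
pose A := carrier R.
have /choice[f fP] (s : seq T) : exists x, {in s, forall a, A a} -> R (s, x).
  have [sA|nsA] := pselect {in s, forall a, A a}; last by exists (j 0%N).
  by have /Rdom[x Rsx] := sA; exists x.
have fA (s : seq T) : {in s, forall a, A a} -> A (f s) by move=> /fP /Rran.
have finj (s t : seq T) : {in s, forall a, A a} -> {in t, forall a, A a} ->
    f s = f t -> s = t.
  by move=> /fP Rs /fP Rt fst; apply: (Rinj _ _ (f s)) => //; rewrite fst.
have A1 a : A a -> {in [:: a], forall a, A a} by move=> Aa b; rewrite inE => /eqP ->.
have A2 a : A a -> {in [:: a; a], forall a, A a}.
  by move=> Aa b; rewrite !inE => /orP[] /eqP ->.
have code_map (B : set T) (e : T -> T) : (forall t, B t -> A (e t)) ->
    {in B &, injective e} ->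
    forall s t : seq T, {in s, forall a, B a} -> {in t, forall a, B a} ->
    f (map e s) = f (map e t) -> s = t.
  move=> eA einj s t sB tB fst.
  have {fst} : map e s = map e t.
    by apply: finj fst => _ /mapP[a + ->] => [/sB|/tB]; exact: eA.
  elim: s t sB tB => [[] //|a s IH [//|b t]] sB tB /= [eab est].
  congr cons.
    by apply: einj eab; rewrite inE; [apply: sB|apply: tB]; rewrite inE eqxx.
  apply: IH est => c cs; first by apply: sB; rewrite inE cs orbT.
  by apply: tB; rewrite inE cs orbT.
have [[h hinj]|[h hinj]] := inj_total {a | ~ A a} {a | A a}.
  pose c t := if pselect (A t) is right nAt
    then [:: sval (h (exist _ t nAt)); sval (h (exist _ t nAt))] else [:: t].
  have cA t : {in c t, forall a, A a}.
    by rewrite /c; case: pselect => [At|nAt]; [exact: A1|apply: A2; exact: svalP].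
  have cinj : injective c.
    move=> a b; rewrite /c.
    case: pselect => [Aa|nAa]; case: pselect => [Ab|nAb] // -[] // /sval_inj.
    by move=> /hinj[].
  exists (fun s => f (map (f \o c) s)) => s t.
  apply: (code_map setT) => // [a _|a b _ _]; first exact/fA/cA.
  by move=> /finj/cinj; apply; exact: cA.
exfalso.
(* [B] is [A] with a disjoint copy of it. Lists of length one and two code [B] back into [A], and
   the lists over [B] that are not lists over [A] are sent into the copy, away from the old
   values. *)
pose B : set T := [set t | A t \/ exists a, t = sval (h a)].
have [h' h'P] : exists h' : T -> T, forall a (Aa : A a), h' a = sval (h (exist _ a Aa)).
  exists (fun a => if pselect (A a) is left Aa then sval (h (exist _ a Aa)) else a).
  by move=> a Aa; case: pselect => // Aa'; rewrite (Prop_irrelevance Aa Aa').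
have h'A a : A a -> ~ A (h' a) by move=> Aa; rewrite (h'P _ Aa); exact: (svalP (h _)).
have h'inj a b : A a -> A b -> h' a = h' b -> a = b.
  by move=> Aa Ab; rewrite (h'P _ Aa) (h'P _ Ab) => /sval_inj/hinj[].
have /choice[e eP] t : exists y, (A t -> y = f [:: t]) /\
    (forall a, A a -> t = h' a -> y = f [:: a; a]).
  have [At|nAt] := pselect (A t).
    exists (f [:: t]); split=> // a Aa ta.
    by exfalso; apply: (h'A a Aa); rewrite -ta.
  have [[a [Aa ta]]|na] := pselect (exists a, A a /\ t = h' a).
    exists (f [:: a; a]); split=> // b Ab tb.
    by rewrite (h'inj a b) // -ta.
  by exists t; split=> // a Aa ta; case: na; exists a.
have BP t : B t -> A t \/ exists2 a, A a & t = h' a.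
  case=> [At|[[a Aa] ->]]; [by left|right].
  by exists a => //; rewrite (h'P _ Aa).
have eA t : B t -> A (e t).
  move=> /BP[At|[a Aa ta]]; first by rewrite (eP t).1 //; apply: fA; exact: A1.
  by rewrite ((eP t).2 a) //; apply: fA; exact: A2.
have einj : {in B &, injective e}.
  move=> t u /set_mem/BP[At|[a Aa ta]] /set_mem/BP[Au|[b Ab ub]].
  - by rewrite (eP t).1 // (eP u).1 // => /finj => /(_ (A1 _ At) (A1 _ Au))[].
  - by rewrite (eP t).1 // ((eP u).2 b) // => /finj => /(_ (A1 _ At) (A2 _ Ab)).
  - by rewrite ((eP t).2 a) // (eP u).1 // => /finj => /(_ (A2 _ Aa) (A1 _ Au)).
  - rewrite ((eP t).2 a) // ((eP u).2 b) // => /finj => /(_ (A2 _ Aa) (A2 _ Ab))[].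
    by rewrite ta ub => ->.
pose inB (s : seq T) := {in s, forall a, B a}.
pose inA (s : seq T) := {in s, forall a, A a}.
have AB s : inA s -> inB s by move=> sA a /sA; left.
have eAs s : inB s -> inA (map e s) by move=> sB _ /mapP[a /sB /eA Ae ->].
pose R' : set (seq T * T) := R `|` [set p |
  [/\ inB p.1, ~ inA p.1 & p.2 = h' (f (map e p.1))]].
have R'B a : carrier R' a <-> B a.
  split=> [[x [Rax|[/= aB _ _]]]|Ba]; first by left; exists x.
    by apply: aB; rewrite inE eqxx.
  have [[x Rax]|nAa] := pselect (A a); first by exists x; left.
  exists (h' (f (map e [:: a]))); right; split=> //=.
    by move=> b; rewrite inE => /eqP ->.
  by move=> /(_ a); rewrite inE eqxx => /(_ isT).
have R'P : P R'.
  split.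
  - move=> s x y [R1|[/= sB nsA ->]] [R2|[/= _ nsA' ->]] //.
    + exact: Rfun R1 R2.
    + by case: nsA'; apply/Rdom; exists x.
    + by case: nsA; apply/Rdom; exists y.
  - move=> s t x [R1|[/= sB nsA xE]] [R2|[/= tB ntA xE']] //.
    + exact: Rinj R1 R2.
    + exfalso; have /Rran := R1; rewrite xE'; apply: h'A; apply: fA; exact: eAs.
    + exfalso; have /Rran := R2; rewrite xE; apply: h'A; apply: fA; exact: eAs.
    + apply: (code_map B e eA einj) => //.
      by apply: h'inj; rewrite -?xE //; apply: fA; exact: eAs.
  - move=> s; split=> [[x [R1|[/= sB _ _]]] a sa|sR'].
    + by apply/R'B; left; apply: (Rdom s).1 sa; exists x.
    + by apply/R'B; exact: sB.
    + have sB : inB s by move=> a /sR' /R'B.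
      have [sA|nsA] := pselect (inA s); last by exists (h' (f (map e s))); right.
      by exists (f s); left; exact: fP.
  - move=> s x [/Rran Ax|[/= sB _ ->]]; apply/R'B; first by left.
    have Af : A (f (map e s)) by apply: fA; exact: eAs.
    by right; exists (exist _ _ Af); rewrite (h'P _ Af).
have A0 : A (j 0%N) by exact: carrier_mono (R0j 0%N).
apply: (h'A _ A0); apply: (@carrier_mono R' R).
  by apply: Rmax => // p Rp; left.
by apply/R'B; right; exists (exist _ _ A0); rewrite (h'P _ A0).
Qed.

Lemma nonfinite_nat_inj (T : Type) : infinite_set [set: T] ->
  exists j : nat -> T, injective j.
Proof. by move=> /infiniteP/card_le_setTP. Qed.

Lemma card_eq_setTP T U : ([set: T] #= [set: U])%card ->
  exists f : T -> U, bijective f.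
Proof.
move=> /card_bijP[f [g fK gK]].
pose i V (x : V) : [set: V] := SigSub (in_setT x).
have iK V (x : [set: V]) : i V (val x) = x by exact: val_inj.
exists (fun x => val (f (i _ x))), (fun y => val (g (i _ y))) => x.
  by rewrite iK fK.
by rewrite iK gK.
Qed.

Section Basis.
Variables (G : zmodType) (G2 : forall g : G, g + g = 0).

Definition independent (X : set G) := forall s : seq G, uniq s ->
  {in s, forall x, X x} -> \sum_(x <- s) x = 0 -> s = [::].

Lemma independent_basis : exists X, independent X /\
  forall g, exists2 s : seq G, {in s, forall x, X x} & g = \sum_(x <- s) x.
Proof.
have [F FP Ftot|X [indX Xmax]] := @Zorn_bigcup _ independent.
  case=> [//|a s us sF].
  have [|||X FX] := @chain_all _ _ F (fun X x => X x) (a :: s) _ Ftot.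
  - by have [|X FX _] := sF a; [rewrite inE eqxx|exists X].
  - by move=> X Y x XY; exact: XY.
  - by move=> x /sF[X FX Xx]; exists X.
  - by move=> sX; have := FP _ FX; apply.
exists X; split=> // g.
have [Xg|nXg] := pselect (X g).
  by exists [:: g]; rewrite ?big_seq1 // => x; rewrite inE => /eqP ->.
have : ~ independent (X `|` [set g]).
  apply: Xmax; split; first by move=> x Xx; left.
  by move=> /(_ g) Xg; apply: nXg; apply: Xg; right.
move=> /existsNP[s] /not_implyP[us] /not_implyP[sX] /not_implyP[s0 snil].
have gs : g \in s.
  apply: contrapT => gs; apply: snil; apply: (indX s us) => // x xs.
  by case: (sX x xs) => // xg; rewrite xg in xs.
exists (rem g s).
  move=> x; rewrite mem_rem_uniq // inE => /andP[/eqP xg /sX[]//].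
by move: s0; rewrite (big_rem _ gs) /= => /(addr_eq0_bool G2).
Qed.

Lemma undup_parity (I : eqType) (s : seq I) :
  exists t : seq I, [/\ uniq t, {subset t <= s},
    forall F : I -> G, \sum_(x <- t) F x = \sum_(x <- s) F x &
    forall f : I -> bool,
      \big[addb/false]_(x <- t) f x = \big[addb/false]_(x <- s) f x].
Proof.
elim: s => [|a s [t [ut ts Et Eft]]]; first by exists [::].
have [at_|at_] := boolP (a \in t); last first.
  exists (a :: t); rewrite /= at_ ut; split=> //.
  - by move=> x; rewrite !inE => /predU1P[->|/ts ->]; rewrite ?eqxx ?orbT.
  - by move=> F; rewrite !big_cons Et.
  - by move=> f; rewrite !big_cons Eft.
exists (rem a t); rewrite rem_uniq //; split=> //.
- by move=> x /mem_rem /ts; rewrite inE => ->; rewrite orbT.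
- by move=> F; rewrite big_cons -Et [in RHS](big_rem _ at_) /= bool_addKr.
- by move=> f; rewrite big_cons -Eft [in RHS](big_rem _ at_) /= addbA addbb addFb.
Qed.

Lemma independent_character X (f : G -> bool) : independent X ->
  (forall g, exists2 s : seq G, {in s, forall x, X x} & g = \sum_(x <- s) x) ->
  exists2 chi, character chi & forall x, X x -> chi x = f x.
Proof.
move=> indX spanX.
have /choice[s sP] g : exists s : seq G, {in s, forall x, X x} /\ g = \sum_(x <- s) x.
  by have [s] := spanX g; exists s.
(* Every relation among basis elements has an even [f]-sum, so [chi] below does not depend on the
   chosen expression [s g]. *)
have par (t : seq G) : {in t, forall x, X x} -> \sum_(x <- t) x = 0 ->
    \big[addb/false]_(x <- t) f x = false.
  move=> tX t0; have [u [uu ut Eu <-]] := undup_parity t.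
  rewrite (indX u uu) ?big_nil // ?Eu // => x /ut; exact: tX.
pose chi g := \big[addb/false]_(x <- s g) f x.
have chiE (t : seq G) g : {in t, forall x, X x} -> g = \sum_(x <- t) x ->
    chi g = \big[addb/false]_(x <- t) f x.
  move=> tX gE; apply/eqP; rewrite -negb_add; apply/negPf.
  rewrite /chi -big_cat /= par ?big_cat /=; [by []| |].
    by move=> x; rewrite mem_cat => /orP[/(sP g).1|/tX].
  by rewrite -gE -(sP g).2 G2.
exists chi => [g h|x Xx].
  rewrite (chiE (s g ++ s h)) ?big_cat //=; last by rewrite -(sP g).2 -(sP h).2.
  by move=> x; rewrite mem_cat => /orP[/(sP g).1|/(sP h).1].
by rewrite (chiE [:: x]) ?big_seq1 // => y; rewrite inE => /eqP ->.
Qed.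

End Basis.

(** A basis of [G] is infinite, as finitely many elements generate only countably many. By [seq_inj]
    it then has as many elements as lists over it, hence as [G], and can be re-indexed by [A]. *)
Lemma free_basis (G : zmodType) (A : Type) : (forall g : G, g + g = 0) ->
  ([set: G] #= [set: nat -> bool])%card ->
  ([set: A] #= [set: nat -> bool])%card ->
  exists b : A -> G,
    (forall g, exists s : seq A, g = \sum_(a <- s) b a) /\
    (forall f : A -> bool, exists2 chi, character chi & forall a, chi (b a) = f a).
Proof.
move=> G2 /card_eqPle[/card_le_setTP[u uinj] /card_le_setTP[w winj]] Acard.
have [X [indX spanX]] := independent_basis G2.
have /choice[s sP] g : exists s : seq X, g = \sum_(x <- s) val x.
  have [s sX ->] := spanX g.
  elim: s sX => [_|a s IH sX]; first by exists [::]; rewrite !big_nil.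
  have [|t Et] := IH; first by move=> x xs; apply: sX; rewrite inE xs orbT.
  have aX : a \in X by apply/mem_set/sX; rewrite inE eqxx.
  by exists (SigSub aX :: t); rewrite !big_cons Et.
have sinj : injective s by move=> g h sgh; rewrite (sP g) (sP h) sgh.
have [Xfin|/nonfinite_nat_inj[j jinj]] := pselect (finite_set [set: X]).
  exfalso; apply: uncountable_cantor; apply/card_le_setTP.
  have /card_le_setTP[k kinj] := finite_set_countable Xfin.
  exists (fun r => pickle (map k (s (w r)))) => r r' /(pcan_inj pickleK).
  by move=> /(inj_map kinj)/sinj/winj.
have [c cinj] := seq_inj jinj.
have XA : ([set: X] #= [set: A])%card.
  apply: card_eq_trans (card_esym Acard).
  apply/card_eqPle; split; apply/card_le_setTP.
    by exists (fun x => u (val x)) => x y /uinj/val_inj.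
  by exists (c \o s \o w); do 2?[apply: inj_comp => //].
have [p [q pK qK]] := card_eq_setTP XA.
exists (fun a => val (q a)); split=> [g|f].
  exists (map p (s g)); rewrite big_map [LHS]sP.
  by apply: eq_bigr => x _; rewrite pK.
have [chi chiD chiX] := independent_character G2
  (fun g => if pselect (X g) is left Xg then f (p (SigSub (mem_set Xg))) else false)
  indX spanX.
exists chi => // a; rewrite chiX; last exact/set_mem/valP.
case: pselect => [Xq|[]]; last exact/set_mem/valP.
by rewrite -[in RHS](qK a); congr (f (p _)); exact: val_inj.
Qed.

(** * The generators *)

Definition le_continuum (T : Type) := exists f : T -> nat -> bool, injective f.

Lemma le_continuum_inj T U (g : T -> U) :
  injective g -> le_continuum U -> le_continuum T.
Proof. by move=> ginj [f finj]; exists (f \o g); exact: inj_comp. Qed.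

Lemma le_continuum_countType (T : countType) : le_continuum T.
Proof.
exists (fun x n => pickle x == n) => x y /(congr1 (@^~ (pickle y))).
by rewrite eqxx => /eqP/(pcan_inj pickleK).
Qed.

Lemma le_continuum_fun (C : countType) T :
  le_continuum T -> le_continuum (C -> T).
Proof.
move=> [f finj].
exists (fun u n => if @unpickle (C * nat)%type n is Some (c, k) then f (u c) k else false).
move=> u v uv; apply/funext => c; apply: finj; apply/funext => k.
by have := congr1 (@^~ (pickle (c, k))) uv; rewrite pickleK.
Qed.

Lemma le_continuum_option T : le_continuum T -> le_continuum (option T).
Proof.
move=> [f finj].
exists (fun o n => if o is Some x then if n is m.+1 then f x m else true else false).
move=> [x|] [y|] // xy; last 2 first.
- by have := congr1 (@^~ 0%N) xy.
- by have := congr1 (@^~ 0%N) xy.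
by congr Some; apply: finj; apply/funext => m; have := congr1 (@^~ m.+1) xy.
Qed.

Lemma le_continuum_prod T U :
  le_continuum T -> le_continuum U -> le_continuum (T * U).
Proof.
move=> [f finj] [g ginj].
apply: (@le_continuum_inj _ (bool -> nat -> bool)
  (fun p b => if b then f p.1 else g p.2)); last first.
  by apply: le_continuum_fun; exists id.
move=> [x y] [x' y'] /= xy; congr pair.
  by apply: finj; exact: (congr1 (@^~ true) xy).
by apply: ginj; exact: (congr1 (@^~ false) xy).
Qed.

Lemma le_continuum_sum T U :
  le_continuum T -> le_continuum U -> le_continuum (T + U).
Proof.
move=> cT cU; apply: (@le_continuum_inj _ (option T * option U)
  (fun s => match s with inl x => (Some x, None) | inr y => (None, Some y) end)).
  by move=> [x|y] [x'|y'] // [->].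
by apply: le_continuum_prod; exact: le_continuum_option.
Qed.

Lemma le_continuum_seq T : le_continuum T -> le_continuum (seq T).
Proof.
move=> cT; apply: (@le_continuum_inj _ (nat -> option T) (@onth T)); last first.
  exact/le_continuum_fun/le_continuum_option.
elim=> [|x s IH] [|y t] // st.
- by have := congr1 (@^~ 0%N) st.
- by have := congr1 (@^~ 0%N) st.
have [<-] := congr1 (@^~ 0%N) st; congr cons; apply: IH.
by apply/funext => n; exact: (congr1 (@^~ n.+1) st).
Qed.

(* [Lim J len tau j] with [J j] stands for the limit, along an ultrafilter
   attached to [(J, len, tau)], of the [j]-th of the sequences
   [x |-> tau j x 0 + ... + tau j x (len j x - 1)]; these are indexed by pairs
   [x = (N, l)], the [l]-th element of the [N]-th block. *)
Inductive gen (K : Type) : Type :=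
| Base of K & nat
| Lim of (nat -> bool) & (nat -> nat * nat -> nat)
    & (nat -> nat * nat -> nat -> gen K) & nat.

Section GenCode.
Variable K : Type.

(** The label at the end of the path [w] in the tree [g]. Labels omit [tau], which is recovered from
    the labels further along; this keeps the codes within the continuum. *)
Fixpoint gen_code (g : gen K) (w : seq (nat * (nat * nat) * nat)) :
    option (K * nat + (nat -> bool) * (nat -> nat * nat -> nat) * nat) :=
  match g, w with
  | Base i k, [::] => Some (inl (i, k))
  | Lim J len _ j, [::] => Some (inr (J, len, j))
  | Base _ _, _ :: _ => None
  | Lim _ _ tau _, (j, x, i) :: w' => gen_code (tau j x i) w'
  end.

Lemma gen_code_inj : injective gen_code.
Proof.
elim=> [i k|J len tau IH j] [i' k'|J' len' tau' j'] gg';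
  have /= := congr1 (@^~ [::]) gg' => // -[]; first by move=> -> ->.
move=> -> -> ->; congr Lim; apply/funext => m; apply/funext => x.
apply/funext => i; apply: IH; apply/funext => w.
exact: (congr1 (@^~ ((m, x, i) :: w)) gg').
Qed.

Lemma gen_continuum (i0 : K) : le_continuum K ->
  ([set: gen K] #= [set: nat -> bool])%card.
Proof.
move=> cK; apply/card_eqPle; split; apply/card_le_setTP.
  apply: (le_continuum_inj gen_code_inj).
  apply: le_continuum_fun; apply: le_continuum_option.
  apply: le_continuum_sum; first exact/le_continuum_prod/le_continuum_countType.
  apply: le_continuum_prod; last exact: le_continuum_countType.
  apply: le_continuum_prod; first by exists id.
  by do 2!apply: le_continuum_fun; exact: le_continuum_countType.
by exists (fun u => Lim u (fun _ _ => 0%N) (fun _ _ _ => Base i0 0) 0) => u v [].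
Qed.

End GenCode.

(** * Filters concentrated on blocks *)

Section Blocks.
Local Open Scope nat_scope.

(* An almost disjoint family and an independent family on the block numbers,
   both indexed by [nat -> bool]: a block number codes a finite sequence [s],
   to be compared with the initial segments of the index, and a finite set [L]
   of sequences of length [m].  The bound on the code of [(m, L)] makes the
   first family almost disjoint. *)
Definition ad_block (f : nat -> bool) (N : nat) : bool :=
  if @pickle_inv (seq bool * (nat * seq (seq bool)))%type N is Some (s, W)
  then (s == mkseq f (size s)) && (pickle W <= size s) else false.

Definition indep_block (h : nat -> bool) (N : nat) : bool :=
  if @pickle_inv (seq bool * (nat * seq (seq bool)))%type N is Some (_, (m, L))
  then mkseq h m \in L else false.

Lemma mkseq_neq (T : eqType) (f g : nat -> T) k n :
  f k <> g k -> k < n -> mkseq f n <> mkseq g n.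
Proof.
move=> fg kn /(congr1 (fun s => nth (f 0) s k)).
by rewrite !nth_mkseq.
Qed.

Lemma ad_block_disjoint f g : f <> g ->
  exists n0, forall N, n0 <= N -> ad_block f N -> ad_block g N -> False.
Proof.
move=> fg; have [k fgk] : exists k, f k <> g k.
  by apply: contrapT => /forallNP fg'; apply: fg; apply/funext => k; apply: contrapT.
pose code a b := if @unpickle (nat * seq (seq bool))%type b is Some W
  then pickle (mkseq f a, W) else 0.
(* A block number common to both families codes a segment of length at most [k], and that length
   bounds its second component, so only finitely many are possible. *)
exists (\max_(a < k.+1) \max_(b < k.+1) code a b).+1 => N n0N.
rewrite /ad_block; case E : (pickle_inv N) => [[s W]|//].
move=> /andP[/eqP sf Ws] /andP[/eqP sg _].
have sk : size s <= k.
  rewrite leqNgt; apply/negP => ks.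
  by apply: (mkseq_neq fgk ks); rewrite -sf -sg.
have NE : N = code (size s) (pickle W).
  rewrite /code pickleK -sf.
  by have := @pickle_invK (seq bool * (nat * seq (seq bool)))%type N; rewrite E.
have : N <= \max_(a < k.+1) \max_(b < k.+1) code a b.
  rewrite NE; have sk1 : size s < k.+1 by [].
  have wk1 : pickle W < k.+1 by rewrite ltnS (leq_trans Ws).
  apply: leq_trans (leq_bigmax (Ordinal sk1)).
  exact: (leq_bigmax (Ordinal wk1)).
by move=> /(leq_trans n0N); rewrite ltnn.
Qed.

Lemma indep_block_hits f (P Q : seq (nat -> bool)) n0 :
  (forall h, h \in P -> h \in Q -> False) ->
  exists N, [/\ n0 <= N, ad_block f N, forall h, h \in P -> indep_block h N &
    forall h, h \in Q -> ~~ indep_block h N].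
Proof.
move=> PQ.
have /choice[k kP] (pq : (nat -> bool) * (nat -> bool)) :
    exists k, pq.1 <> pq.2 -> pq.1 k <> pq.2 k.
  apply: contrapT => /forallNP nk.
  have pq12 : pq.1 = pq.2.
    apply/funext => i; apply: contrapT => pqi; apply: (nk i) => _; exact: pqi.
  by apply: (nk 0).
(* Digits below [m] tell every element of [P] from every element of [Q], and [W] stores the initial
   segments of [P]. Lengthening the segment of [f] by [n] respects the bound on [pickle W] and makes
   the block number arbitrarily large. *)
pose m := (\max_(p <- P) \max_(q <- Q) k (p, q)).+1.
pose W : nat * seq (seq bool) := (m, [seq mkseq p m | p <- P]).
pose code n := @pickle (seq bool * (nat * seq (seq bool)))%type (mkseq f (pickle W + n), W).
have code_inj : injective code.
  move=> a b /(pcan_inj pickleK)[/(congr1 size)].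
  by rewrite !size_mkseq => /addnI.
have [n n0n] := injective_gtn code_inj n0.
exists (code n); split; first exact: ltnW.
- by rewrite /ad_block pickleK_inv size_mkseq eqxx leq_addr.
- by move=> p pP; rewrite /indep_block pickleK_inv /=; apply/mapP; exists p.
- move=> q qQ; rewrite /indep_block pickleK_inv /=; apply/negP => /mapP[p pP].
  apply/eqP; rewrite eq_sym; apply/eqP.
  apply: (@mkseq_neq _ _ _ (k (p, q))).
    by apply: (kP (p, q)) => /= pq; apply: (PQ p) => //; rewrite pq.
  rewrite ltnS; apply: leq_trans (leq_bigmax_seq _ pP isT).
  exact: (leq_bigmax_seq _ qQ isT).
Qed.

(** A single [s] bounds both the exceptional initial blocks and, in units of [waste N], the indices
    missed; for an intersection the two values are added. *)
Definition block_filter (f : nat -> bool) : set_system (nat * nat) :=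
  [set U | exists s, forall N, s <= N -> ad_block f N ->
    #|[pred l : 'I_(width N) | ~~ `[< U (N, nat_of_ord l) >]]| <= s * waste N].

Lemma block_filter_hits f U : block_filter f U ->
  exists s, forall N, s <= N -> ad_block f N ->
    exists2 l, l < width N & U (N, l).
Proof.
move=> [s sU]; exists s => N sN fN.
pose bad := [pred l : 'I_(width N) | ~~ `[< U (N, nat_of_ord l) >]].
have : 0 < #|predC bad|.
  rewrite -(ltn_add2l #|bad|) addn0 cardC card_ord (leq_ltn_trans (sU N sN fN)) //.
  by rewrite /width ltnS leq_mul // ltnW.
by move=> /card_gt0P[l]; rewrite !inE negbK => /asboolP Ul; exists l.
Qed.

Lemma block_filter_filter f : Filter (block_filter f).
Proof.
split.
- exists 0 => N _ _; rewrite leqn0; apply/eqP/eq_card0 => l.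
  by rewrite !inE asboolT.
- move=> A B [s sA] [t tB]; exists (s + t) => N stN fN.
  rewrite mulnDl.
  apply: leq_trans (leq_add (sA N _ fN) (tB N _ fN)).
  + rewrite -cardUI; apply: leq_trans (leq_addr _ _); apply: subset_leq_card.
    apply/fintype.subsetP => l; rewrite !inE -negb_and; apply: contra.
    by move=> /andP[/asboolP Al /asboolP Bl]; apply/asboolP; split.
  + by rewrite (leq_trans _ stN) // leq_addr.
  + by rewrite (leq_trans _ stN) // leq_addl.
- move=> A B AB [s sA]; exists s => N sN fN; apply: leq_trans (sA N sN fN).
  apply: subset_leq_card; apply/fintype.subsetP => l; rewrite !inE; apply: contra.
  by move=> /asboolP /AB Bl; apply/asboolP.
Qed.

Lemma block_filter_tail f n : block_filter f [set x | n <= x.1].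
Proof.
exists n => N nN _; apply: leq_trans (leq0n _).
by rewrite leqn0; apply/eqP/eq_card0 => l; rewrite !inE asboolT.
Qed.

(** [indep_block_hits] realizes any finite part of [sel] on arbitrarily late blocks of [f], where a
    set of the filter still contains an index; so all of [sel] can be imposed. *)
Lemma block_ultrafilter f (sel : (nat -> bool) -> bool) :
  exists p : set_system (nat * nat), [/\ UltraFilter p, block_filter f `<=` p &
    forall h, p [set x | indep_block h x.1 = sel h]].
Proof.
have FF := block_filter_filter f.
pose F : set_system (nat * nat) := [set A | exists (U : set (nat * nat)) (hs : seq (nat -> bool)),
  block_filter f U /\
  (forall x, U x -> {in hs, forall h, indep_block h x.1 = sel h} -> A x)].
have F_filter : ProperFilter F.
  split.
    move=> [U [hs [/block_filter_hits[s sU] nU]]].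
    have [|N [sN fN hP hQ]] := @indep_block_hits f [seq h <- hs | sel h] [seq h <- hs | ~~ sel h] s.
      by move=> h; rewrite !mem_filter => /andP[->].
    have [l _ Ul] := sU N sN fN.
    apply: (nU _ Ul) => h hhs /=; have [sh|sh] := boolP (sel h).
      by apply: hP; rewrite mem_filter sh.
    by apply/negbTE/hQ; rewrite mem_filter sh.
  split.
  - by exists setT, [::]; split=> //; exact: filterT.
  - move=> A B [U [hs [fU UA]]] [V [ks [fV VB]]]; exists (U `&` V), (hs ++ ks).
    split; first exact: filterI.
    move=> x [Ux Vx] hk; split; [apply: UA|apply: VB] => // h hh; apply: hk.
      by rewrite mem_cat hh.
    by rewrite mem_cat hh orbT.
  - move=> A B AB [U [hs [fU UA]]]; exists U, hs; split=> // x Ux xhs.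
    by apply: AB; exact: UA.
have [p [pU Fp]] := ultraFilterLemma F_filter.
exists p; split=> //.
  by move=> U fU; apply: Fp; exists U, [::].
move=> h; apply: Fp; exists setT, [:: h]; split; first exact: filterT.
by move=> x _ /(_ h); rewrite inE => /(_ (eqxx _)).
Qed.

End Blocks.

(** * Characters with prescribed limits *)

Lemma ultra_bool_limit T (p : set_system T) (u : T -> bool) : UltraFilter p ->
  p [set x | u x = `[< p [set y | u y] >]].
Proof.
move=> pU; have [pu|npu] := pselect (p [set y | u y]).
  by rewrite asboolT //; apply: filterS pu => x.
rewrite asboolF //; have [//|] := in_ultra_setVsetC [set y | u y] pU.
by apply: filterS => x /negP/negbTE.
Qed.

Section Characters.
Variables (K : Type) (i0 : K) (G : zmodType) (G2 : forall g : G, g + g = 0).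
Variable b : gen K -> G.
Hypothesis b_span : forall g, exists s : seq (gen K), g = \sum_(a <- s) b a.
Hypothesis b_free :
  forall f : gen K -> bool, exists2 chi, character chi & forall a, chi (b a) = f a.

Record tuple := Tuple {
  tJ : nat -> bool;
  tlen : nat -> nat * nat -> nat;
  ttau : nat -> nat * nat -> nat -> gen K }.

Definition tlim T j : gen K := Lim (tJ T) (tlen T) (ttau T) j.

Definition tval T j x : G := \sum_(i < tlen T j x) b (ttau T j x i).

Definition valid : set tuple := [set T |
  ~ ([set: K] #<= [set j | tJ T j])%card /\
  forall N, block_free N (tJ T) (fun j l => tval T j (N, l))].

Hypothesis K_continuum : le_continuum K.

Lemma lim_inj T T' j j' : tlim T j = tlim T' j' -> T = T' /\ j = j'.
Proof. by case: T T' => [J l t] [J' l' t'] [-> -> -> ->]. Qed.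

Lemma tuple_continuum : le_continuum tuple.
Proof.
have /card_eqPle[/card_le_setTP[f finj] _] := gen_continuum i0 K_continuum.
by exists (fun T => f (tlim T 0)) => T T' /finj/lim_inj[].
Qed.

Definition tcode : tuple -> nat -> bool := sval (cid tuple_continuum).

Lemma tcode_inj : injective tcode.
Proof. exact: svalP (cid tuple_continuum). Qed.

Definition tfilter T := block_filter (tcode T).

#[global] Instance tfilter_filter T : Filter (tfilter T) :=
  block_filter_filter (tcode T).

Definition limit_in (E : set tuple) (g : gen K) :=
  exists T j, [/\ E T, tJ T j & g = tlim T j].

Definition uses T g := exists j x i, g = ttau T j x i.

Definition chars (E : set tuple) (p : tuple -> set_system (nat * nat))
    (chi : G -> bool) :=
  character chi /\ forall T, E T -> forall j, tJ T j ->
    p T [set x | chi (tval T j x) = chi (b (tlim T j))].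

Lemma character_tval chi T j x : character chi ->
  chi (tval T j x) = \big[addb/false]_(i < tlen T j x) chi (b (ttau T j x i)).
Proof. by move=> chiD; rewrite /tval character_sum. Qed.

Fixpoint extension (upd : set tuple) (p : tuple -> set_system (nat * nat))
    (f : gen K -> bool) (g : gen K) : bool :=
  match g with
  | Base _ _ => f g
  | Lim J len tau j =>
    if `[< upd (Tuple J len tau) /\ J j >]
    then `[< p (Tuple J len tau) [set x |
              \big[addb/false]_(i < len j x) extension upd p f (tau j x i)] >]
    else f g
  end.

(** Values at limits of tuples in [E] but not in [D] are recomputed as ultralimits, by recursion on
    generators; the others are kept. The equations for [D] survive, because limits from [E] used by
    [D] already belong to [D]. *)
Lemma chars_extend (D E : set tuple) p chi :
  D `<=` E -> (forall T, E T -> UltraFilter (p T)) ->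
  (forall T g, D T -> uses T g -> limit_in E g -> limit_in D g) ->
  chars D p chi ->
  exists2 chi', chars E p chi' &
    forall g, (limit_in E g -> limit_in D g) -> chi' (b g) = chi (b g).
Proof.
move=> DE pU Dclosed [chiD chip].
pose upd := E `\` D.
have [chi' chi'D chi'E] := b_free (extension upd p (chi \o b)).
have agree g : (limit_in E g -> limit_in D g) -> chi' (b g) = chi (b g).
  rewrite chi'E; case: g => [//|J len tau j] /= kg.
  rewrite asboolF // => -[[ET nDT] Jj].
  have [|T' [j' [DT' _ /(lim_inj (T := Tuple J len tau))[TE _]]]] := kg.
    by exists (Tuple J len tau), j.
  by apply: nDT; rewrite TE.
exists chi' => //; split=> // T ET j Jj; have pT := pU _ ET.
have [DT|nDT] := pselect (D T).
  rewrite agree; last by exists T, j.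
  apply: filterS (chip _ DT _ Jj) => x /= <-.
  rewrite !character_tval //; apply: eq_bigr => i _; apply: agree.
  by apply: Dclosed DT _; exists j, x, i.
rewrite (chi'E (tlim T j)) /= asboolT; last by case: T ET Jj nDT pT.
have -> : Tuple (tJ T) (tlen T) (ttau T) = T by case: T {ET Jj nDT pT}.
apply: filterS (ultra_bool_limit (chi' \o tval T j) pT) => x /= ->.
congr (`[< p T _ >]); apply/funext => y /=.
by rewrite character_tval //; congr is_true; apply: eq_bigr => i _; rewrite chi'E.
Qed.

(** Different tuples own almost disjoint sets of blocks. Each block is given to the first tuple that
    owns it, so every tuple loses only finitely many of its blocks to earlier ones, and
    [block_character] applies. *)
Lemma tuple_character (e : nat -> tuple) (x0 : G) (t : tuple -> nat -> G)
    (beta : tuple -> nat -> nat * nat -> bool) :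
  (forall n, valid (e n)) -> x0 <> 0 ->
  exists chi, [/\ character chi, chi x0 & forall n j, tJ (e n) j ->
    tfilter (e n) [set x |
      chi (tval (e n) j x) = chi (t (e n) j) && beta (e n) j x]].
Proof.
move=> ev x00.
have /choice[m mP] N : exists m, (exists n, ad_block (tcode (e n)) N) ->
    ad_block (tcode (e m)) N /\
    forall n, ad_block (tcode (e n)) N -> (m <= n)%N.
  have [ex|nex] := pselect (exists n, ad_block (tcode (e n)) N); last by exists 0%N.
  by exists (ex_minn ex) => _; case: ex_minnP.
have [|chi [chiD chix0 chiE]] := @block_character G G2 x0
  (fun N => tJ (e (m N))) (fun N j l => tval (e (m N)) j (N, l))
  (fun N => t (e (m N))) (fun N j l => beta (e (m N)) j (N, l)) _ x00.
  by move=> N; exact: (ev _).2.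
exists chi; split=> // n0 j.
have [n <- nmin] : exists2 n, e n = e n0 & forall n', (n' < n)%N -> e n' <> e n.
  have ex : exists n, `[< e n = e n0 >] by exists n0; apply/asboolP.
  exists (ex_minn ex); case: ex_minnP => n /asboolP en nmin //.
  move=> n' n'n; rewrite en => en'; move: n'n; rewrite ltnNge => /negP; apply.
  by apply: nmin; apply/asboolP.
move=> Jj.
have /choice[thr thrP] (n' : nat) : exists r, (n' < n)%N ->
    forall N, (r <= N)%N -> ad_block (tcode (e n')) N ->
      ad_block (tcode (e n)) N -> False.
  have [n'n|] := boolP (n' < n)%N; last by exists 0%N.
  have [|r rP] := @ad_block_disjoint (tcode (e n')) (tcode (e n)).
    by move=> /tcode_inj; exact: nmin.
  by exists r.
(* Beyond this bound no earlier tuple owns the block and [j] is one of its rows; the successor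
   leaves room for one [waste N]. *)
exists (maxn j (\max_(n' < n) thr n')).+1 => N sN nN.
have mN : m N = n.
  have [mN mmin] := mP N (ex_intro _ n nN).
  apply/eqP; rewrite eqn_leq mmin //= leqNgt; apply/negP => mn.
  apply: (thrP _ mn N) => //; apply: leq_trans (ltnW sN).
  by rewrite (leq_trans _ (leq_maxr _ _)) // (leq_bigmax (Ordinal mn)).
have [L Ls LP] := chiE N; rewrite mulSn (leq_trans _ (leq_addr _ _)) //.
apply: leq_trans Ls; apply: subset_leq_card; apply/fintype.subsetP => l.
rewrite !inE; apply: contraR => lL; apply/asboolP => /=.
have := LP j l; rewrite mN; apply => //.
by rewrite (leq_trans _ (ltnW sN)) // leq_maxl.
Qed.

Fixpoint subgen (g : gen K) (w : seq (nat * (nat * nat) * nat)) {struct w} :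
    gen K :=
  if w is (j, x, i) :: w' then
    if g is Lim _ _ tau _ then subgen (tau j x i) w' else g
  else g.

Lemma subgen_rcons g w J len tau j c : subgen g w = Lim J len tau j ->
  subgen g (rcons w c) = tau c.1.1 c.1.2 c.2.
Proof.
case: c => [[m x] i].
elim: w g => [|[[j' x'] i'] w IH] [i1 k|J' len' tau' j''] //=; last exact: IH.
by move=> [_ _ ->].
Qed.

Definition trivial_tuple :=
  Tuple xpred0 (fun _ _ => 0%N) (fun _ _ _ => Base i0 0).

Lemma trivial_tuple_valid : valid trivial_tuple.
Proof.
split=> [/= K0|N c cJ _ i]; last by apply/negbTE/negP => /cJ.
move: K0; rewrite (_ : [set j | _] = set0); last by apply/seteqP; split.
by move=> /card_le0P K0; suff : [set: K] i0 by rewrite K0.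
Qed.

(** Finitely many trees have countably many subtrees, so the valid tuples met among these can be
    enumerated, with [trivial_tuple] as a default that names no limit. *)
Lemma subgen_closure (s : seq (gen K)) : exists e : nat -> tuple,
  [/\ forall n, valid (e n),
      forall k, (k < size s)%N -> limit_in valid (nth (Base i0 0) s k) ->
        limit_in (range e) (nth (Base i0 0) s k) &
      forall n g, uses (e n) g -> limit_in valid g -> limit_in (range e) g].
Proof.
pose dec n := if @unpickle (nat * seq (nat * (nat * nat) * nat))%type n is Some (k, w)
  then subgen (nth (Base i0 0) s k) w else Base i0 0.
pose e n := if dec n is Lim J len tau j
  then if pselect (valid (Tuple J len tau)) is left _ then Tuple J len tau
       else trivial_tuple
  else trivial_tuple.
have range_e n T j : valid T -> dec n = tlim T j -> e n = T.
  by move=> vT; rewrite /e => ->; case: T vT => J len tau vT /=; case: pselect.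
have limE k w : limit_in valid (subgen (nth (Base i0 0) s k) w) ->
    limit_in (range e) (subgen (nth (Base i0 0) s k) w).
  move=> [T [j [vT Jj gT]]]; exists T, j; split=> //.
  exists (pickle (k, w)) => //; apply: (@range_e _ _ j) => //.
  by rewrite /dec pickleK.
exists e; split.
- move=> n; rewrite /e; case: (dec n) => [_ _|J len tau j].
    exact: trivial_tuple_valid.
  by case: pselect => // _; exact: trivial_tuple_valid.
- by move=> k _; exact: (limE k [::]).
- move=> n g; rewrite /e /dec; case: unpickle => [[k w]|]; last first.
    by move=> [j [x [i ->]]] [T [j' [_ _]]].
  case E : subgen => [i k'|J len tau j].
    by move=> [j [x [i' ->]]] [T [j' [_ _]]].
  case: pselect => [vT|_]; last by move=> [j' [x [i' ->]]] [T [j'' [_ _]]].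
  move=> [j' [x [i ->]]] /=.
  by rewrite -[tau j' x i](subgen_rcons (j', x, i) E); exact: limE.
Qed.

Section Assignment.
Variable p : tuple -> set_system (nat * nat).

(** Only the countably many tuples reachable from an expression of [x0] affect the value there.
    [tuple_character] treats these, and [chars_extend] adds the rest of [E] without changing that
    value. *)
Lemma chars_separate (E : set tuple) x0 : E `<=` valid ->
  (forall T, E T -> UltraFilter (p T) /\ tfilter T `<=` p T) -> x0 <> 0 ->
  exists2 chi, chars E p chi & chi x0.
Proof.
move=> Ev pE x00; have [s x0s] := b_span x0.
have [e [ev es eu]] := subgen_closure s.
have [chi [chiD chix0 chiF]] :=
  @tuple_character e x0 (fun T j => b (tlim T j)) (fun _ _ _ => true) ev x00.
have [||T g||chi' chi'E agree] := @chars_extend (E `&` range e) E p chi.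
- by move=> T [].
- by move=> T /pE[].
- move=> [ET [n _ <-]] ug [T' [j [ET' Jj gT']]].
  have [|T'' [j' [T''r Jj' gT'']]] := eu n g ug.
    by exists T', j; split=> //; exact: Ev.
  by exists T', j; split=> //; split=> //; case: (lim_inj (etrans (esym gT'') gT')) => <-.
- split=> // T [ET [n _ nT]] j Jj; apply: (pE T ET).2; rewrite -nT in Jj *.
  by apply: filterS (chiF n j Jj) => x /= ->; rewrite andbT.
exists chi' => //; suff -> : chi' x0 = chi x0 by [].
rewrite x0s !character_sum //; last by case: chi'E.
rewrite !(big_nth (Base i0 0)) !big_mkord; apply: eq_bigr => k _; apply: agree.
move=> [T [j [ET Jj gT]]].
have [|T' [j' [T'r Jj' gT']]] := es k (ltn_ord k).
  by exists T, j; split=> //; exact: Ev.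
by exists T, j; split=> //; split=> //; case: (lim_inj (etrans (esym gT') gT)) => <-.
Qed.

(** As [T0] is outside [E], its sequences need not converge to its formal limits, and [beta] can
    prescribe the values along them. *)
Lemma chars_free (E : set tuple) T0 (A : seq nat) (B : nat * nat -> bool) :
  E `<=` valid -> (forall T, E T -> UltraFilter (p T) /\ tfilter T `<=` p T) ->
  valid T0 -> ~ E T0 -> uniq A -> A != [::] -> {in A, forall j, tJ T0 j} ->
  exists2 chi, chars E p chi &
    tfilter T0 [set x | chi (\sum_(j <- A) tval T0 j x) = B x].
Proof.
move=> Ev pE vT0 nET0 uA A0 AJ.
have [a aA] : exists a, a \in A.
  by case: (A) A0 => // a A' _; exists a; rewrite inE eqxx.
have x00 : b (Base i0 0) <> 0.
  move=> b0; have [chi chiD chib] := b_free xpredT.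
  by have := chib (Base i0 0); rewrite b0 character0.
have [e [ev es eu]] := subgen_closure [:: tlim T0 a].
have [n0 _ n0T] : range e T0.
  have [|T [j [Tr _ /lim_inj[-> _]]]//] := es 0%N isT.
  by exists T0, a; split=> //; exact: AJ.
(* For [T0] the formal limits are replaced by [b (Base i0 0)], where [chi] is true. Row [a] then
   takes the values [B] and the other rows vanish, so the sum over [A] takes the values [B]. *)
have [chi [chiD chix0 chiF]] := @tuple_character e (b (Base i0 0))
  (fun T j => if pselect (T = T0) is left _ then b (Base i0 0) else b (tlim T j))
  (fun T j x => if pselect (T = T0) is left _ then (j == a) && B x else true) ev x00.
have [||T g||chi' chi'E agree] := @chars_extend (E `&` range e) E p chi.
- by move=> T [].
- by move=> T /pE[].
- move=> [ET [n _ <-]] ug [T' [j [ET' Jj gT']]].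
  have [|T'' [j' [T''r Jj' gT'']]] := eu n g ug.
    by exists T', j; split=> //; exact: Ev.
  by exists T', j; split=> //; split=> //; case: (lim_inj (etrans (esym gT'') gT')) => <-.
- split=> // T [ET [n _ nT]] j Jj; apply: (pE T ET).2; rewrite -nT in Jj *.
  apply: filterS (chiF n j Jj) => x /= ->; case: pselect => [eT0|_]; last by rewrite andbT.
  by case: nET0; rewrite -eT0 nT.
exists chi' => //.
have chiA : tfilter T0 [set x | {in A, forall j, chi (tval T0 j x) = (j == a) && B x}].
  elim: (A) AJ {uA A0 aA} => [|j A1 IH] AJ.
    by apply: filterS filterT => x _ j.
  have {}IH : tfilter T0 [set x | {in A1, forall j, chi (tval T0 j x) = (j == a) && B x}].
    by apply: IH => k kA; apply: AJ; rewrite inE kA orbT.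
  have Jj : tJ (e n0) j by rewrite n0T; apply: AJ; rewrite inE eqxx.
  have := chiF n0 j Jj; rewrite n0T; case: pselect => // _; rewrite chix0 /= => jF.
  apply: filterS (filterI jF IH) => x [/= xj xA] k.
  by rewrite inE => /predU1P[->//|/xA].
apply: filterS chiA => x xA /=.
have tvE j : chi' (tval T0 j x) = chi (tval T0 j x).
  rewrite !character_tval //; last by case: chi'E.
  apply: eq_bigr => i _; apply: agree => -[T [j' [ET Jj gT]]].
  have [||T' [j'' [T'r Jj' gT']]] := eu n0 (ttau T0 j x i).
  - by rewrite n0T; exists j, x, i.
  - by exists T, j'; split=> //; exact: Ev.
  by exists T, j'; split=> //; split=> //; case: (lim_inj (etrans (esym gT') gT)) => <-.
rewrite character_sum; last by case: chi'E.
rewrite (bigD1_seq a) //= tvE xA // eqxx /= big_seq_cond big1 ?addbF //.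
by move=> j /andP[jA /negbTE ja]; rewrite tvE xA // ja.
Qed.

End Assignment.
End Characters.

(** * Formal combinations modulo two and a dimension count *)

Definition odd_in (K : Type) (s : seq K) (i : K) : bool :=
  \big[addb/false]_(i' <- s) `[< i' = i >].

(** A list over [K] stands for a formal combination with coefficients modulo two; this expresses
    that it is nonzero. *)
Definition odd_somewhere (K : Type) (s : seq K) := exists i, odd_in s i.

Lemma odd_in_uniq (I : finType) (K : Type) (f : I -> K) (u : I -> bool) i :
  injective f -> odd_in [seq f x | x <- enum I & u x] (f i) = u i.
Proof.
move=> finj; rewrite /odd_in big_map big_filter big_enum_cond /= big_mkcond /=.
rewrite (bigD1 i) //= big1; first by rewrite asboolT // addbF; case: (u i).
move=> x /eqP xi; rewrite asboolF; first by case: (u x).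
by move=> /finj.
Qed.

Lemma not_card_le_II (K : Type) n : ~ (exists f : K -> 'I_n, injective f) ->
  exists f : 'I_n.+1 -> K, injective f.
Proof.
move=> nKn; case: (inj_total K 'I_n.+1) => // -[g ginj].
have [gsurj|/existsNP[m /forallNP gm]] := pselect (forall m, exists x, g x = m).
  have [h hP] := choice gsurj.
  by exists h => x y hxy; rewrite -(hP x) -(hP y) hxy.
exfalso; apply: nKn.
have /choice[h hP] x : exists k, g x = lift m k.
  have := unliftP m (g x); case: unliftP => [k ->|gx] _; first by exists k.
  by case: (gm x).
by exists h => x y hxy; apply: ginj; rewrite hP hxy -hP.
Qed.

Lemma card_le_inj_in (T U : Type) (f : T -> U) (B : set U) :
  injective f -> (forall x, B (f x)) -> ([set: T] #<= B)%card.
Proof.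
move=> finj fB; have fi : {in [set: T] &, injective f} by move=> x y _ _; exact: finj.
have /card_eqPle[_ fT] := inj_card_eq fi.
by apply: card_le_trans fT _; apply: subset_card_le => _ [x _ <-].
Qed.

(** The rows [c i] are linearly independent. If [J] has finite size [r], then among [r + 1] rows two
    different subsets would have the same sum, since [2 ^ (r + 1)] exceeds [2 ^ r]. If [J] is
    infinite, distinct indices have distinct finite lists [A i], so [K] is countable. *)
Lemma independent_card (K : Type) (J : nat -> bool) (A : K -> seq nat)
    (c : K -> nat -> bool) :
  (forall i i', A i = A i' -> c i = c i') ->
  (forall i j, c i j -> J j) ->
  (forall s, odd_somewhere s -> exists j, \big[addb/false]_(i <- s) c i j) ->
  ([set: K] #<= [set j | J j])%card.
Proof.
move=> cA cJ cfree.
have [Jfin|/infiniteP Jinf] := pselect (finite_set [set j | J j]); last first.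
  apply: card_le_trans Jinf; apply/card_le_setTP.
  exists (fun i => pickle (A i)) => i i' /(pcan_inj pickleK) Aii'.
  apply: contrapT => ii'; have [|j] := cfree [:: i; i'].
    exists i; rewrite /odd_in big_cons big_seq1 asboolT // asboolF //.
    by move=> i'i; exact: ii'.
  by rewrite big_cons big_seq1 (cA _ _ Aii') addbb.
have /finite_seqP[r0 Jr0] := Jfin; pose r := undup r0.
have Jr j : J j = (j \in r).
  have -> : J j = `[< [set j | J j] j >] by rewrite asboolb.
  by rewrite Jr0 mem_undup; apply/asboolP/idP.
have [[g ginj]|/not_card_le_II[f finj]] := pselect (exists f : K -> 'I_(size r), injective f).
  apply: (@card_le_inj_in _ _ (fun i => nth 0%N r (g i))) => [i i' /eqP|i].
    by rewrite nth_uniq ?undup_uniq // => /eqP/val_inj/ginj.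
  by rewrite /= Jr mem_nth.
exfalso.
pose phi (u : {ffun 'I_(size r).+1 -> bool}) : {ffun 'I_(size r) -> bool} :=
  [ffun m => \big[addb/false]_(x | u x) c (f x) (nth 0%N r (m : 'I_(size r)))].
have /injectivePn[u [u' uu' phiuu']] : ~~ injectiveb phi.
  apply/negP => /injectiveP/leq_card.
  by rewrite !card_ffun !card_bool !card_ord leq_exp2l // ltnn.
have [x ux] : exists x, u x (+) u' x.
  apply: contrapT => /forallNP nux; move/eqP: uu'; apply; apply/ffunP => x.
  by apply/eqP; rewrite -[_ == _]negbK negb_eqb; exact/negP.
have [|j] := cfree [seq f x | x <- enum 'I_(size r).+1 & u x (+) u' x].
  by exists (f x); rewrite odd_in_uniq.
rewrite big_map big_filter big_enum_cond /=.
have [jr|jr] := boolP (j \in r); last first.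
  by rewrite big1 // => y _; apply/negbTE; apply: contra jr => /cJ; rewrite Jr.
have jm : (index j r < size r)%N by rewrite index_mem.
have := congr1 (fun v : {ffun _ -> _} => v (Ordinal jm)) phiuu'; rewrite !ffunE /= nth_index // => E.
have -> : \big[addb/false]_(y | u y (+) u' y) c (f y) j =
    \big[addb/false]_(y | u y) c (f y) j (+) \big[addb/false]_(y | u' y) c (f y) j.
  rewrite big_mkcond [X in X (+) _]big_mkcond [X in _ (+) X]big_mkcond -big_split /=.
  by apply: eq_bigr => y _; case: (u y) (u' y) (c _ _) => [] [] [].
by rewrite E addbb.
Qed.

(** * The choice of the ultrafilters *)

Definition free_ultrafilter (q : set_system nat) :=
  UltraFilter q /\ forall n, q [set k | (n <= k)%N].

Lemma ultra_meet T (q : set_system T) (A B : set T) : UltraFilter q ->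
  q A -> q B -> exists2 x, A x & B x.
Proof.
move=> qU qA qB; have qAB : q (A `&` B) by exact: (filterI qA qB).
by have [x [Ax Bx]] := filter_ex qAB; exists x.
Qed.

Lemma ultra_asbool T (q : set_system T) (u : T -> bool) (c : bool) :
  UltraFilter q -> q [set k | u k = c] -> `[< q [set k | u k] >] = c.
Proof.
move=> qU quc.
by have [k /= <- <-] := ultra_meet qU quc (ultra_bool_limit u qU).
Qed.

Section Existence.
Variables (K : Type) (i0 : K) (G : zmodType) (G2 : forall g : G, g + g = 0).
Variable b : gen K -> G.
Hypothesis b_span : forall g, exists s : seq (gen K), g = \sum_(a <- s) b a.
Hypothesis b_free :
  forall f : gen K -> bool, exists2 chi, character chi & forall a, chi (b a) = f a.
Hypothesis K_continuum : le_continuum K.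
Hypothesis G_continuum : le_continuum G.

Notation tuple := (tuple K).
Notation valid := (valid b).
Notation tval := (tval b).
Notation tfilter := (tfilter i0 K_continuum).
Notation chars := (chars b).
Implicit Types (D E : set tuple) (p : tuple -> set_system (nat * nat)).
Implicit Types (q : set_system nat) (s : seq K) (a : G).

Definition known D g := limit_in valid g -> limit_in D g.

(** The subgroup generated by the known generators, written as an intersection of subgroups so that
    it serves as an induction principle. *)
Definition known_span D a := forall S : set G, S 0 ->
  (forall x y, S x -> S y -> S (x + y)) -> (forall g, known D g -> S (b g)) -> S a.

Lemma known_span0 D : known_span D 0.
Proof. by move=> S S0. Qed.

Lemma known_spanD D x y : known_span D x -> known_span D y -> known_span D (x + y).
Proof.
move=> Dx Dy S S0 Sadd Sgen.
by apply: (Sadd); [exact: (Dx S S0 Sadd Sgen)|exact: (Dy S S0 Sadd Sgen)].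
Qed.

Lemma known_span_gen D g : known D g -> known_span D (b g).
Proof. by move=> Dg S S0 SD; apply. Qed.

Lemma known_span_sum D (I : Type) (r : seq I) (P : pred I) (F : I -> G) :
  (forall i, P i -> known_span D (F i)) -> known_span D (\sum_(i <- r | P i) F i).
Proof.
move=> DF; apply: (big_ind (known_span D)) => // x y; exact: known_spanD.
Qed.

Lemma known_base D i k : known D (Base i k).
Proof. by move=> [T [j []]]. Qed.

Lemma limit_inS D E g : D `<=` E -> limit_in D g -> limit_in E g.
Proof. by move=> DE [T [j [DT Jj gT]]]; exists T, j; split=> //; exact: DE. Qed.

Lemma known_spanS D E a : D `<=` E -> known_span D a -> known_span E a.
Proof.
move=> DE Da S S0 SD SE; apply: Da => // g Dg; apply: SE => vg.
by apply: limit_inS DE _; exact: Dg.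
Qed.

Definition base_sum s k : G := \sum_(i <- s) b (Base i k).

Lemma known_base_sum D s k : known_span D (base_sum s k).
Proof.
by apply: known_span_sum => i _; apply: known_span_gen; exact: known_base.
Qed.

Definition qlim D p q s a :=
  forall chi, chars D p chi -> q [set k | chi (base_sum s k) = chi a].

Definition reached D p q :=
  exists s a, [/\ odd_somewhere s, known_span D a & qlim D p q s a].

Definition coherent D p :=
  [/\ D `<=` valid,
      forall T, D T -> UltraFilter (p T) /\ tfilter T `<=` p T &
      forall T g, D T -> uses T g -> known D g].

Definition prevents D p := forall q, free_ultrafilter q ->
  exists i, forall a, known_span D a -> ~ qlim D p q [:: i] a.

(* Once some nontrivial combination of the base sequences has a [q]-limit, no
   new [q]-limits are allowed; this is what makes [prevents] pass to unions of
   chains. *)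
Definition extends D p E r := [/\ D `<=` E, forall T, D T -> p T = r T &
  forall q, free_ultrafilter q -> reached D p q ->
    forall s a, known_span E a -> qlim E r q s a ->
    exists2 a', known_span D a' & qlim D p q s a'].

Lemma chars_agree D chi chi' : character chi -> character chi' ->
  (forall g, known D g -> chi' (b g) = chi (b g)) ->
  forall a, known_span D a -> chi' a = chi a.
Proof.
move=> chiD chi'D agree a Da; apply: (Da [set a | chi' a = chi a]) => //=.
  by rewrite !character0.
by move=> x y xE yE; rewrite chiD chi'D xE yE.
Qed.

Lemma chars_restrict D p E r chi : D `<=` E -> (forall T, D T -> p T = r T) ->
  chars E r chi -> chars D p chi.
Proof.
move=> DE pr [chiD chiE]; split=> // T DT j Jj.
by rewrite pr //; apply: chiE => //; exact: DE.
Qed.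

Lemma chars_lift D p E r chi : coherent D p -> coherent E r ->
  D `<=` E -> (forall T, D T -> p T = r T) -> chars D p chi ->
  exists2 chi', chars E r chi' & forall a, known_span D a -> chi' a = chi a.
Proof.
move=> [Dv pU Duse] [Ev rU Euse] DE pr [chiD chip].
have [||||chi' chi'E agree] := @chars_extend K G b b_free D E r chi.
- exact: DE.
- by move=> T /rU[].
- move=> T g DT Tg Eg; apply: Duse DT Tg _; exact: limit_inS Ev Eg.
- by split=> // T DT j Jj; rewrite -pr //; exact: chip.
exists chi' => //; apply: chars_agree => //; first by case: chi'E.
move=> g Dg; apply: agree => Eg; apply: Dg; exact: limit_inS Ev Eg.
Qed.

(** Characters for [D] lift to [E] with the same values on base sequences and on elements known to
    [D], so enlarging the stage neither creates nor destroys such a limit. *)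
Lemma qlim_restrict D p E r q s a : coherent D p -> coherent E r ->
  free_ultrafilter q -> D `<=` E -> (forall T, D T -> p T = r T) ->
  known_span D a -> (qlim E r q s a <-> qlim D p q s a).
Proof.
move=> cD cE [qU _] DE pr Da; split=> lim_a chi chiP.
  have [chi' chi'E agree] := chars_lift cD cE DE pr chiP.
  apply: filterS (lim_a _ chi'E) => k /=.
  by rewrite !agree //; exact: known_base_sum.
by apply: lim_a; exact: chars_restrict chiP.
Qed.

Lemma qlimD D p q s t x y : free_ultrafilter q -> qlim D p q s x ->
  qlim D p q t y -> qlim D p q (s ++ t) (x + y).
Proof.
move=> [qU _] qx qy chi chiP; have [chiD _] := chiP.
apply: filterS2 (qx _ chiP) (qy _ chiP) => k /= xE yE.
by rewrite /base_sum big_cat !chiD -xE -yE.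
Qed.

Lemma base_character D p s (B : nat -> bool) : coherent D p -> odd_somewhere s ->
  exists2 chi, chars D p chi & forall k, chi (base_sum s k) = B k.
Proof.
move=> [Dv pU _] [i si].
have [chi chiD chib] := b_free (fun g =>
  if g is Base i' k then `[< i' = i >] && B k else false).
have [||||chi' chi'E agree] :=
  @chars_extend K G b b_free set0 D p chi.
- by [].
- by move=> T /pU[].
- by [].
- by split.
exists chi' => // k; have [chi'D _] := chi'E.
rewrite /base_sum character_sum //.
rewrite (eq_bigr (fun i' => `[< i' = i >] && B k)); last first.
  by move=> i' _; rewrite agree ?chib // => -[T [j []]].
by rewrite -big_distrl /= -/(odd_in s i) si.
Qed.

(** By [base_character] the values along [base_sum s] can be the indicator of any set, so the limit
    [a] decides which sets belong to [q]. Reached ultrafilters are thus determined by pairs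
    [(s, a)]. *)
Lemma qlim_unique D p q q' s a : coherent D p -> odd_somewhere s ->
  free_ultrafilter q -> free_ultrafilter q' ->
  qlim D p q s a -> qlim D p q' s a -> q = q'.
Proof.
move=> cD so fq fq' qa q'a.
have sub r r' : free_ultrafilter r -> free_ultrafilter r' ->
    qlim D p r s a -> qlim D p r' s a -> r `<=` r'.
  move=> [rU _] [r'U _] ra r'a B rB.
  have [chi chiP chiB] := base_character (fun k => `[< B k >]) cD so.
  have chia : chi a.
    have [k /= <- Bk] := ultra_meet rU (ra _ chiP) rB.
    by rewrite chiB; exact/asboolP.
  apply: filterS (r'a _ chiP) => k /=.
  by rewrite chiB chia => /asboolP.
by apply/seteqP; split; exact: sub.
Qed.

Lemma prevents_empty p : prevents set0 p.
Proof.
move=> q [qU qfree]; exists i0 => a Da qa.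
have [s aE] : exists s : seq (gen K), a = \sum_(g <- s) b g by exact: b_span.
pose level (m : 'I_(size s)) :=
  if nth (Base i0 0) s m is Base _ k then k else 0%N.
(* All levels occurring in [a] are below [n], so the character that is true exactly on base
   generators of level at least [n] vanishes at [a] but not along the sequence. *)
pose n := (\max_m level m).+1.
have [chi chiD chib] := b_free (fun g =>
  if g is Base _ k then (n <= k)%N else false).
have chi0 : chars set0 p chi by split.
have [k /= + nk] := ultra_meet qU (qa _ chi0) (qfree n).
rewrite /base_sum big_seq1 chib nk aE character_sum //.
rewrite (big_nth (Base i0 0)) big_mkord big1 // => m _; rewrite chib.
have : (level m <= \max_m level m)%N by exact: leq_bigmax.
rewrite {1}/level; case: nth => // _ k' k'n.
by apply/negbTE; rewrite -ltnNge ltnS.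
Qed.

Lemma extends_refl D p : extends D p D p.
Proof. by split=> // q _ _ s a Da qa; exists a. Qed.

Lemma reached_mono D p E r q : coherent D p -> coherent E r ->
  D `<=` E -> (forall T, D T -> p T = r T) -> free_ultrafilter q ->
  reached D p q -> reached E r q.
Proof.
move=> cD cE DE pr fq [s [a [so Da qa]]]; exists s, a; split=> //.
  exact: known_spanS Da.
exact/(qlim_restrict _ cD cE fq DE pr Da).
Qed.

Lemma extends_trans D p E r F t : coherent D p -> coherent E r ->
  extends D p E r -> extends E r F t -> extends D p F t.
Proof.
move=> cD cE [DE pr DElim] [EF rt EFlim]; split.
- exact: subset_trans EF.
- by move=> T DT; rewrite pr // rt //; exact: DE.
- move=> q fq Dq s a Fa qa.
  have [a' Ea' qa'] := EFlim q fq (reached_mono cD cE DE pr fq Dq) s a Fa qa.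
  exact: DElim qa'.
Qed.

Definition state := {Dp : set tuple * (tuple -> set_system (nat * nat)) |
  coherent Dp.1 Dp.2 /\ prevents Dp.1 Dp.2}.

Definition state_le (x y : state) : bool :=
  `[< extends (sval x).1 (sval x).2 (sval y).1 (sval y).2 >].

Lemma empty_state : state.
Proof.
exists (set0, fun=> setT); split; last exact: prevents_empty.
by split.
Qed.

(** An element known to the union is known to some member. If all base sequences converged along [q]
    in the union, one limit would make [q] reached at a stage [x]; by [extends] all of them would
    then have limits at [x], against [prevents] there. *)
Lemma state_sup (A : set state) : total_on A state_le ->
  exists t, forall x, A x -> state_le x t.
Proof.
move=> Atot; have [[x0 Ax0]|A0] := pselect (A !=set0); last first.
  by exists empty_state => x Ax; case: A0; exists x.
pose D (x : state) := (sval x).1; pose p (x : state) := (sval x).2.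
have coh (x : state) : coherent (D x) (p x) by case: (svalP x).
pose U := \bigcup_(x in A) D x.
have [r rP] : exists r : tuple -> set_system (nat * nat),
    forall x T, A x -> D x T -> p x T = r T.
  have /choice[r rP] (T : tuple) : exists rT, forall x, A x -> D x T -> p x T = rT.
    have [[x [Ax DxT]]|nT] := pselect (exists x, A x /\ D x T); last first.
      by exists setT => x Ax DxT; case: nT; exists x.
    exists (p x T) => y Ay DyT.
    by have [/asboolP[_ xy _]|/asboolP[_ yx _]] := Atot _ _ Ax Ay; [rewrite /p xy|rewrite /p yx].
  by exists r => x T Ax; exact: rP.
have DU x : A x -> D x `<=` U by move=> Ax T DT; exists x.
have cU : coherent U r.
  split.
  - by move=> T [x Ax DT]; have [+ _ _] := coh x; apply.
  - move=> T [x Ax DT]; rewrite -(rP x T) //; have [_ + _] := coh x; exact.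
  - move=> T g [x Ax DT] Tg vg; have [_ _ xuse] := coh x.
    exact: limit_inS (DU x Ax) (xuse _ _ DT Tg vg).
have spanU a : known_span U a -> exists2 x, A x & known_span (D x) a.
  move=> Ua; apply: (Ua [set a | exists2 x, A x & known_span (D x) a]).
  - by exists x0 => //; exact: known_span0.
  - move=> a1 a2 [x Ax xa] [y Ay yb].
    have [/asboolP[xy _ _]|/asboolP[yx _ _]] := Atot _ _ Ax Ay.
      by exists y => //; apply: known_spanD => //; exact: known_spanS xa.
    by exists x => //; apply: known_spanD => //; exact: known_spanS yb.
  - move=> g Ug; have [vg|nvg] := pselect (limit_in valid g); last first.
      by exists x0 => //; apply: known_span_gen => /nvg.
    have [T [j [[x Ax DT] Jj gT]]] := Ug vg.
    by exists x => //; apply: known_span_gen => _; exists T, j.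
have ext x : A x -> extends (D x) (p x) U r.
  move=> Ax; split; first exact: DU.
    by move=> T DT; exact: rP.
  move=> q fq xq s a /spanU[y Ay ya] qa.
  have {}qa : qlim (D y) (p y) q s a.
    exact/(qlim_restrict s (coh y) cU fq (DU y Ay) (fun T => rP y T Ay) ya).
  have [/asboolP[_ _ xylim]|/asboolP[yx yp _]] := Atot _ _ Ax Ay; first exact: xylim qa.
  exists a; first exact: known_spanS ya.
  exact/(qlim_restrict s (coh y) (coh x) fq yx yp ya).
have prevU : prevents U r.
  move=> q fq; apply: contrapT => /forallNP nq.
  have qi i : exists2 a, known_span U a & qlim U r q [:: i] a.
    have /existsNP[a /not_implyP[Ua /contrapT qa]] := nq i.
    by exists a.
  have [a /spanU[x Ax xa] qa] := qi i0.
  have xq : reached (D x) (p x) q.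
    exists [:: i0], a; split=> //; first by exists i0; rewrite /odd_in big_seq1 asboolT.
    exact/(qlim_restrict _ (coh x) cU fq (DU x Ax) (fun T => rP x T Ax) xa).
  have [_ xprev] := svalP x; have [i xi] := xprev q fq.
  have [a' Ua' qa'] := qi i; have [_ _ xlim] := ext x Ax.
  by have [a'' xa'' /xi] := xlim q fq xq _ _ Ua' qa'; apply.
exists (exist (fun Dp : set tuple * (tuple -> set_system (nat * nat)) =>
  coherent Dp.1 Dp.2 /\ prevents Dp.1 Dp.2) (U, r) (conj cU prevU)).
by move=> x Ax; apply/asboolP; exact: ext.
Qed.

Lemma known_span_setU1 D T0 y : known_span (D `|` [set T0]) y ->
  exists a A, [/\ known_span D a, uniq A, {in A, forall j, tJ T0 j} &
    y = a + \sum_(j <- A) b (tlim T0 j)].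
Proof.
pose S := [set y | exists a A, [/\ known_span D a, {in A, forall j, tJ T0 j} &
    y = a + \sum_(j <- A) b (tlim T0 j)]].
move=> Ey; have : S y.
  apply: Ey.
  - by exists 0, [::]; split=> //; rewrite big_nil addr0.
  - move=> _ _ [a1 [A1 [Da1 JA1 ->]]] [a2 [A2 [Da2 JA2 ->]]].
    exists (a1 + a2), (A1 ++ A2); split; first exact: known_spanD.
      by move=> j; rewrite mem_cat => /orP[/JA1|/JA2].
    by rewrite big_cat addrACA.
  - move=> g Eg; have [Dg|nDg] := pselect (known D g).
      exists (b g), [::]; split=> //; first exact: known_span_gen.
      by rewrite big_nil addr0.
    have vg : limit_in valid g by apply: contrapT => nvg; apply: nDg => /nvg.
    have [T [j [[DT|TT0] Jj gT]]] := Eg vg.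
      by case: nDg => _; exists T, j.
    exists 0, [:: j]; split; first exact: known_span0.
      by move=> i; rewrite inE => /eqP ->; rewrite -TT0.
    by rewrite big_seq1 add0r gT TT0.
move=> [a [A [Da JA yE]]].
have [B [uB BA EB _]] := undup_parity G2 A.
by exists a, B; split=> //; [move=> j /BA; exact: JA|rewrite EB].
Qed.

Section Step.
Variables (D : set tuple) (p : tuple -> set_system (nat * nat)) (T0 : tuple).
Hypotheses (cD : coherent D p) (prevD : prevents D p).
Hypotheses (vT0 : valid T0) (nDT0 : ~ D T0).
Hypothesis use0 : forall g, uses T0 g -> known D g.

Lemma known_tval0 j x : known_span D (tval T0 j x).
Proof.
by apply: known_span_sum => i _; apply: known_span_gen; apply: use0; exists j, x, i.
Qed.

(* The new limits avoid all the points [q-lim base_sum s' + a'] with [q]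
   already reached: these are at most continuum many, and for each of them and
   each [A] an independent family of blocks leaves one binary choice. *)
Lemma avoiding_ultrafilter : exists p0 : set_system (nat * nat),
  [/\ UltraFilter p0, tfilter T0 `<=` p0 &
  forall q A s a s' a', free_ultrafilter q -> odd_somewhere s ->
    qlim D p q s a -> uniq A -> A != [::] -> {in A, forall j, tJ T0 j} ->
    exists2 chi, chars D p chi &
      p0 [set x | chi (\sum_(j <- A) tval T0 j x) =
        ~~ (chi a' (+) `[< q [set k | chi (base_sum s' k)] >])]].
Proof.
have [Dv pU Duse] := cD.
(* A code consists of [A], a pair [(s, a)] that determines [q] by [qlim_unique], and the pair
   [(s', a')] to be avoided. *)
pose Z := (seq nat * (seq K * G) * (seq K * G))%type.
have [h hinj] : le_continuum Z.
  have cKG : le_continuum (seq K * G) by apply: le_continuum_prod => //; exact: le_continuum_seq.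
  apply: le_continuum_prod => //; apply: le_continuum_prod => //.
  exact: (le_continuum_countType (seq nat)).
have /choice[chi chiP] (z : Z) : exists chi,
    uniq z.1.1 -> z.1.1 != [::] -> {in z.1.1, forall j, tJ T0 j} ->
    chars D p chi /\ tfilter T0 [set x |
      chi (\sum_(j <- z.1.1) tval T0 j x) = indep_block (h z) x.1].
  have [[uA A0 AJ]|nA] := pselect
      [/\ uniq z.1.1, z.1.1 != [::] & {in z.1.1, forall j, tJ T0 j}]; last first.
    by exists xpred0 => uA A0 AJ; case: nA.
  have [chi chiP chiA] := @chars_free K i0 G G2 b b_free K_continuum p D T0
    z.1.1 (fun x => indep_block (h z) x.1) Dv pU vT0 nDT0 uA A0 AJ.
  by exists chi.
have /choice[Q QP] (z : Z) : exists Q, (exists q, free_ultrafilter q /\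
    qlim D p q z.1.2.1 z.1.2.2) ->
    free_ultrafilter Q /\ qlim D p Q z.1.2.1 z.1.2.2.
  have [[q qP]|nq] := pselect (exists q, free_ultrafilter q /\
    qlim D p q z.1.2.1 z.1.2.2); first by exists q.
  by exists setT.
(* With this value on the [A]-combination, adding [chi a'] gives the opposite of the [q]-limit along
   [s']. *)
pose bit z := ~~ (chi z z.2.2 (+) `[< Q z [set k | chi z (base_sum z.2.1 k)] >]).
have [p0 [p0U fp0 p0h]] := block_ultrafilter (tcode i0 K_continuum T0)
  (fun f => `[< exists2 z, f = h z & bit z >]).
have bitE z : `[< exists2 z', h z = h z' & bit z' >] = bit z.
  apply/asboolP/idP => [[z' /hinj <- //]|bz]; by exists z.
exists p0; split=> // q A s a s' a' fq so qa uA A0 AJ.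
pose z : Z := (A, (s, a), (s', a')).
have [chizP chizA] := chiP z uA A0 AJ.
have [fQ Qa] : free_ultrafilter (Q z) /\ qlim D p (Q z) s a.
  by apply: (QP z); exists q.
have -> : q = Q z by exact: qlim_unique qa Qa.
exists (chi z) => //.
by apply: filterS2 (fp0 _ chizA) (p0h (h z)) => x /= -> ->; rewrite bitE.
Qed.

Lemma extension_step : exists r, [/\ coherent (D `|` [set T0]) r,
  prevents (D `|` [set T0]) r & extends D p (D `|` [set T0]) r].
Proof.
have [p0 [p0U fp0 avoid]] := avoiding_ultrafilter.
have [Dv pU Duse] := cD.
set E := D `|` [set T0].
pose r T := if pselect (T = T0) is left _ then p0 else p T.
have rD T : D T -> p T = r T.
  by rewrite /r; case: pselect => // TT0; rewrite TT0 => /nDT0.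
have r0 : r T0 = p0 by rewrite /r; case: pselect.
have DE : D `<=` E by move=> T; left.
have cE : coherent E r.
  split.
  - by move=> T [/Dv //|->].
  - by move=> T [DT|->]; [rewrite -rD //; exact: pU|rewrite r0].
  - move=> T g [DT|->] Tg vg; apply: limit_inS DE _.
      exact: Duse DT Tg vg.
    exact: use0 Tg vg.
(* When [q] is reached, [avoid] gives a character telling any element with a nonempty new part from
   the [q]-limit of [s']. *)
have new q s a A s' a' : free_ultrafilter q -> odd_somewhere s ->
    known_span D a -> qlim D p q s a -> known_span D a' -> uniq A -> A != [::] ->
    {in A, forall j, tJ T0 j} ->
    ~ qlim E r q s' (a' + \sum_(j <- A) b (tlim T0 j)).
  move=> fq so Da qa Da' uA A0 AJ q'lim; have [qU _] := fq.
  have [chi chiP chi0] := avoid q A s a s' a' fq so qa uA A0 AJ.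
  have [chi' chi'E agree] := chars_lift cD cE DE rD chiP.
  have [chi'D chi'lim] := chi'E.
  have limA : p0 [set x | chi' (\sum_(j <- A) tval T0 j x) =
      chi' (\sum_(j <- A) b (tlim T0 j))].
    elim: (A) AJ {uA A0 q'lim chi0} => [|j B IH] BJ.
      by apply: filterS filterT => x _ /=; rewrite !big_nil.
    have ET0 : E T0 by right.
    have := chi'lim T0 ET0 j (BJ j (mem_head _ _)); rewrite r0 => limj.
    apply: filterS2 limj (IH _) => [x /= xj xB|k kB]; last first.
      by apply: BJ; rewrite inE kB orbT.
    by rewrite !big_cons !chi'D xj xB.
  have [x /= xlim xchi] := ultra_meet p0U limA chi0.
  have := ultra_asbool qU (q'lim _ chi'E).
  rewrite chi'D -xlim !agree //; last by apply: known_span_sum => j _; exact: known_tval0.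
  rewrite xchi.
  have -> : [set k | chi' (base_sum s' k)] = [set k | chi (base_sum s' k)].
    by apply/funext => k /=; rewrite agree //; exact: known_base_sum.
  by case: (chi a') (`[< _ >]) => [] [].
have ext : extends D p E r.
  split=> // q fq [s [a [so Da qa]]] s' y Ey qy.
  have [a' [A [Da' uA AJ yE]]] := known_span_setU1 Ey.
  have [A0|A0] := eqVneq A [::]; last first.
    by case: (new q s a A s' a'); rewrite -?yE.
  rewrite A0 big_nil addr0 in yE; exists a' => //.
  by apply/(qlim_restrict s' cD cE fq DE rD Da'); rewrite -yE.
exists r; split=> // q fq; apply: contrapT => /forallNP nq.
have /choice[y yP] i : exists y, known_span E y /\ qlim E r q [:: i] y.
  have /existsNP[y /not_implyP[Ey /contrapT qy]] := nq i.
  by exists y.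
have [Dq|nDq] := pselect (reached D p q).
  have [i iP] := prevD fq; have [_ _ /(_ q fq Dq)elim] := ext.
  by have [a Da /iP] := elim _ _ (yP i).1 (yP i).2; apply.
have /choice[aA aAP] i : exists aA : G * seq nat, [/\ known_span D aA.1, uniq aA.2,
    {in aA.2, forall j, tJ T0 j} &
    y i = aA.1 + \sum_(j <- aA.2) b (tlim T0 j)].
  by have [a [A aAP]] := known_span_setU1 (yP i).1; exists (a, A).
(* Here [q] is not reached from [D]. If the new parts cancelled in some nonzero combination, its
   limit would be known to [D] and [q] would be reached; so the new parts are independent, against
   the bound on [tJ T0]. *)
have [/(_ _)nK _] := vT0; apply: nK.
apply: (@independent_card K (tJ T0) (fun i => (aA i).2) (fun i j => j \in (aA i).2)).
- by move=> i i' ->.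
- by move=> i j jA; have [_ _ + _] := aAP i; apply.
move=> s so; apply: contrapT => /forallNP sA; apply: nDq.
exists s, (\sum_(i <- s) (aA i).1); split=> //.
  by apply: known_span_sum => i _; have [] := aAP i.
have sumD : known_span D (\sum_(i <- s) (aA i).1).
  by apply: known_span_sum => i _; have [] := aAP i.
apply/(qlim_restrict s cD cE fq DE rD sumD).
have -> : \sum_(i <- s) (aA i).1 = \sum_(i <- s) y i.
  pose F j := b (tlim T0 j).
  have -> : \sum_(i <- s) y i = \sum_(i <- s) (aA i).1 +
      \sum_(i <- s) \sum_(j <- (aA i).2) F j.
    by rewrite -big_split; apply: eq_bigr => i _; have [] := aAP i.
  rewrite [X in _ = _ + X](_ : _ = 0) ?addr0 //.
  (* Each [j] occurs an even number of times in the concatenated lists, so reduction modulo two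
     leaves the empty list and the new limits cancel. *)
  have [t [ut _ EF Ef]] := undup_parity G2 (flatten [seq (aA i).2 | i <- s]).
  have t0 : t = [::].
    case: t ut EF Ef => // j t /andP[jt _] _ /(_ (pred1 j)).
    rewrite big_cons /= eqxx big_seq big1; last first.
      by move=> k kt; apply/negbTE; apply: contraNneq jt => <-.
    rewrite big_flatten big_map /= => E1; case: (sA j).
    suff -> : \big[addb/false]_(i <- s) (j \in (aA i).2) =
      \big[addb/false]_(i <- s) \big[addb/false]_(k <- (aA i).2) (k == j).
      by rewrite -E1.
    apply: eq_bigr => i _.
    have [_ uA _ _] := aAP i; case: (boolP (j \in _)) => jA.
      rewrite (bigD1_seq j) //= eqxx big1 // => k /negbTE.
      by rewrite eq_sym => ->.
    rewrite big_seq big1 // => k kA; apply/negbTE; apply: contraNneq jA => <-.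
    by [].
  by have := EF F; rewrite t0 big_nil big_flatten big_map => <-.
elim: (s) => [|i t IH].
  move=> chi _; have [qU _] := fq; apply: filterS filterT => k _ /=.
  by rewrite /base_sum !big_nil.
by rewrite big_cons; exact: (@qlimD E r q [:: i] t _ _ fq (yP i).2 IH).
Qed.

End Step.

(** Generators are well-founded trees: if no missing tuple were minimal, induction would make every
    generator known, and [D] would contain every valid tuple. *)
Lemma minimal_missing D : D `<=` valid -> D <> valid ->
  exists T, [/\ valid T, ~ D T & forall g, uses T g -> known D g].
Proof.
move=> Dv DNv; apply: contrapT => /forallNP none.
have inD T : valid T -> (forall g, uses T g -> known D g) -> D T.
  by move=> vT uT; apply: contrapT => nDT; apply: (none T).
have allk g : known D g.
  elim: g => [i k|J len tau IH j]; first exact: known_base.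
  move=> [T [j' [vT Jj gT]]]; exists T, j'; split=> //.
  apply: inD => // g [m [x [i ->]]].
  by case: T vT Jj gT => J' len' tau' _ _ [_ _ <- _]; exact: IH.
by apply: DNv; apply/seteqP; split=> // T vT; apply: inD.
Qed.

(** A maximal state covers all valid tuples, for [minimal_missing] and [extension_step] would
    enlarge any other. *)
Lemma complete_assignment : exists p, coherent valid p /\ prevents valid p.
Proof.
have [| |A Atot|[[D p] /= [cD prevD]] Dmax] := @ZL_preorder state empty_state state_le.
- by move=> x; apply/asboolP; exact: extends_refl.
- move=> y x z /asboolP xy /asboolP yz; apply/asboolP.
  by apply: extends_trans xy yz; [case: (svalP y)|case: (svalP x)] => -[].
- exact: state_sup.
have [DE|DNv] := pselect (D = valid).
  by exists p; rewrite -DE.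
have [T0 [vT0 nDT0 use0]] : exists T, [/\ valid T, ~ D T & forall g, uses T g -> known D g].
  by apply: minimal_missing => //; have [] := cD.
have [r [cE prevE ext]] := extension_step cD prevD vT0 nDT0 use0.
pose E : state := exist (fun Dp : set tuple * (tuple -> set_system (nat * nat)) =>
  coherent Dp.1 Dp.2 /\ prevents Dp.1 Dp.2) (D `|` [set T0], r) (conj cE prevE).
have /asboolP[/= ED _ _] := Dmax E (asboolT ext).
by case: nDT0; apply: ED; right.
Qed.

End Existence.

(** * Simultaneous limits of sequences *)

Lemma ultra_setU T (q : set_system T) (A B : set T) : UltraFilter q ->
  q (A `|` B) -> q A \/ q B.
Proof.
move=> qU qAB; have [|qA] := in_ultra_setVsetC A qU; first by left.
right; apply: filterS2 qAB qA => x [//|Bx _ //].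
Qed.

Lemma free_ultrafilter_exists : exists u, free_ultrafilter u.
Proof.
have [u [uU fu]] := ultraFilterLemma eventually_filter.
by exists u; split=> // n; apply: fu; exists n.
Qed.

Section Independence.
Variables (G : zmodType) (G2 : forall g : G, g + g = 0).
Variables (u : set_system nat) (u_free : free_ultrafilter u).
Variables (S : nat -> bool) (f : nat -> nat -> G).

#[local] Instance uU : UltraFilter u. Proof. by case: u_free. Qed.

Definition u_const (h : nat -> G) := exists c, u [set k | h k = c].

Lemma u_const_span E h : u [set k | span E (h k)] -> u_const h.
Proof.
elim: E h => [h hE|e E IH h /ultra_setU[/IH //|/IH[c hc]]]; first by exists 0.
by exists (c + e); apply: filterS hc => k /= <-; rewrite -addrA G2 addr0.
Qed.

(* The indices of a basis of the sequences [f j], [S j], modulo those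
   constant along [u]. *)
Definition u_basis (j : nat) : bool := S j &&
  ~~ `[< exists2 A : seq nat, {in A, forall i, S i && (i < j)%N} &
     u_const (fun k => f j k + \sum_(i <- A) f i k) >].

Lemma u_basis_span j : S j -> exists (A : seq nat) c,
  {in A, forall i, u_basis i} /\ u [set k | f j k = \sum_(i <- A) f i k + c].
Proof.
elim/ltn_ind: j => j IH Sj.
have [bj|] := boolP (u_basis j).
  exists [:: j], 0; split; first by move=> i; rewrite inE => /eqP ->.
  by apply: filterS filterT => k _ /=; rewrite big_seq1 addr0.
rewrite /u_basis Sj /= negbK => /asboolP[A AS [c Ac]].
have [B [d [Bb Bd]]] : exists (B : seq nat) d, {in B, forall i, u_basis i} /\
    u [set k | \sum_(i <- A) f i k = \sum_(i <- B) f i k + d].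
  elim: (A) AS => [_|i A' IHA AS].
    exists [::], 0; split=> //; apply: filterS filterT => k _ /=.
    by rewrite !big_nil addr0.
  have [|B [d [Bb Bd]]] := IHA.
    by move=> m mA; apply: AS; rewrite inE mA orbT.
  have /andP[Si ij] := AS i (mem_head _ _).
  have [B' [d' [Bb' Bd']]] := IH i ij Si.
  exists (B' ++ B), (d' + d); split.
    by move=> m; rewrite mem_cat => /orP[/Bb'|/Bb].
  apply: filterS2 Bd Bd' => k /= EA Ei.
  by rewrite big_cons EA Ei big_cat /= addrACA.
exists B, (c + d); split=> //; apply: filterS2 Ac Bd => k /= Ek EA.
by rewrite addrCA -EA -Ek -addrA G2 addr0.
Qed.

Lemma u_basis_free (N : nat) (a : 'I_N.+1 -> bool) :
  (forall j, a j -> u_basis j) -> (exists j, a j) ->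
  ~ u_const (fun k => \sum_(j < N.+1) f j k *+ a j).
Proof.
move=> ab [j0 aj0] [c uc].
(* The largest index with a nonzero coefficient would reduce to smaller ones up to a constant, so it
   would not belong to [u_basis]. *)
pose j := [arg max_(j > j0 | a j) (j : nat)].
have [aj jmax] : a j /\ forall i, a i -> (i <= j)%N.
  by rewrite /j; case: arg_maxnP => // i ai imax.
have := ab j aj; rewrite /u_basis => /andP[Sj] /negP; apply; apply/asboolP.
exists [seq nat_of_ord i | i <- enum 'I_N.+1 & a i && (i != j)].
  move=> _ /mapP[i + ->]; rewrite mem_filter => /andP[/andP[ai ij] _].
  by have /andP[-> _] := ab i ai; rewrite ltn_neqAle ij jmax.
exists c; apply: filterS uc => k /= <-.
rewrite (bigD1 j) //= aj; congr (_ + _).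
rewrite big_map big_filter big_enum_cond /= [LHS]big_mkcond [RHS]big_mkcond /=.
by apply: eq_bigr => i _; case: (a i) (i != j) => [] [].
Qed.

(** For fixed nonzero coefficients, the [k] that put the combination into the span of earlier values
    do not form a set of [u]: that span is finite, so the combination would be constant along [u].
    As there are finitely many coefficient vectors, some [k] in [W] avoids them all. *)
Lemma block_next N (W : set nat) (h : seq nat) : u W -> exists k, W k /\
  forall a : 'I_N.+1 -> bool, (forall j, a j -> u_basis j) -> (exists j, a j) ->
    ~ span [seq f (j : nat) k' | j <- iota 0 N.+1, k' <- h] (\sum_(j < N.+1) f j k *+ a j).
Proof.
move=> uW; set E := [seq _ | _ <- _, _ <- _].
pose bad (a : {ffun 'I_N.+1 -> bool}) : set nat :=
  [set k | ~ ((forall j, a j -> u_basis j) /\ (exists j, a j) /\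
    span E (\sum_(j < N.+1) f j k *+ a j))].
have ub : u [set k | forall a, bad a k].
  apply: filter_forall => a.
  have [|nb] := in_ultra_setVsetC (bad a) uU; first by [].
  exfalso.
  have [[ab a0]|nab] := pselect ((forall j, a j -> u_basis j) /\ (exists j, a j)).
    apply: (u_basis_free ab a0); apply: (@u_const_span E).
    by apply: filterS nb => k /= /contrapT[_ [_ ]].
  have : u set0; last exact: filter_not_empty.
  by apply: filterS nb => k /= /contrapT[ab [a0 _]]; case: nab.
have [k Wk kb] := ultra_meet uU uW ub.
exists k; split=> // a ab a0 aE; apply: (kb (finfun a)).
split; first by move=> j; rewrite ffunE; exact: ab.
split; first by have [j aj] := a0; exists j; rewrite ffunE.
by rewrite (eq_bigr (fun j : 'I_N.+1 => f j k *+ a j)) // => j _; rewrite ffunE.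
Qed.

(** The indices are chosen successively by [block_next]; in a dependence, a nonzero combination in
    the last column used would lie in the span of the earlier ones. *)
Lemma free_block N (W : set nat) : u W -> exists kappa : nat -> nat,
  (forall l, W (kappa l)) /\ block_free N u_basis (fun j l => f j (kappa l)).
Proof.
move=> uW; have /choice[next nextP] h := block_next N h uW.
pose hist l := iter l (fun h => next h :: h) [::].
exists (fun l => next (hist l)); split=> [l|]; first by have [] := nextP (hist l).
have hist_mem l l' : (l' < l)%N -> next (hist l') \in hist l.
  elim: l => // l IH; rewrite ltnS leq_eqVlt => /predU1P[->|/IH ll'].
    by rewrite /= mem_head.
  by rewrite /= inE ll' orbT.
move=> c cb c0 i1; apply/negbTE/negP => ci1.
pose l := [arg max_(l > i1.2 | [exists j, c (j, l)]) (l : nat)].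
have [/existsP exl lmax] : [exists j, c (j, l)] /\
    forall l', [exists j, c (j, l')] -> (l' <= l)%N.
  rewrite /l; case: arg_maxnP => [|l' cl' lmax]; last by split.
  by apply/existsP; exists i1.1; case: (i1) ci1.
have [_ /(_ (fun j => c (j, l)))nspan] := nextP (hist l).
apply: nspan => //; first by move=> j /cb.
have -> : \sum_(j < N.+1) f j (next (hist l)) *+ c (j, l) =
    \sum_(i : 'I_N.+1 * 'I_(width N) | i.2 != l) f i.1 (next (hist i.2)) *+ c i.
  move: c0; rewrite (bigID (fun i => i.2 == l)) /= => /(addr_eq0_bool G2) <-.
  transitivity (\sum_(j < N.+1) \sum_(l' < width N | l' == l)
      f j (next (hist l')) *+ c (j, l')).
    by apply: eq_bigr => j _; rewrite big_pred1_eq.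
  by rewrite pair_big_dep; apply: eq_bigr => -[j l'].
apply: (span_sum G2) => -[j l'] l'l.
have {}l'l : l' != l by [].
rewrite -[(j, l').1]/j -[(j, l').2]/l'.
case cjl' : (c (j, l')); last by rewrite mulr0n; exact: span0.
have l'lt : (l' < l)%N.
  by rewrite ltn_neqAle l'l lmax //; apply/existsP; exists j.
rewrite mulr1n; apply: (span_mem G2); apply: allpairs_f; last exact: hist_mem.
by rewrite mem_iota /=.
Qed.

End Independence.

Section CommonLimit.
Variables (K : Type) (i0 : K) (G : zmodType) (G2 : forall g : G, g + g = 0).
Variable b : gen K -> G.
Hypothesis b_span : forall g, exists s : seq (gen K), g = \sum_(a <- s) b a.
Hypothesis K_continuum : le_continuum K.
Variable p : tuple K -> set_system (nat * nat).
Hypothesis p_coherent : coherent i0 b K_continuum (valid b) p.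

Lemma common_limit (S : nat -> bool) (f : nat -> nat -> G) :
  ~ ([set: K] #<= [set j | S j])%card ->
  exists (P : set_system (nat * nat)) (kappa : nat * nat -> nat) (y : nat -> G),
    [/\ UltraFilter P, forall n, P [set x | (n <= kappa x)%N] &
      forall chi, chars b (valid b) p chi -> forall j, S j ->
        P [set x | chi (f j (kappa x)) = chi (y j)]].
Proof.
move=> SK; have [u fu] := free_ultrafilter_exists; have [uU utail] := fu.
have /choice[R RP] j : exists Rc : seq nat * G, S j ->
    {in Rc.1, forall i, u_basis u S f i} /\
    u [set k | f j k = \sum_(i <- Rc.1) f i k + Rc.2].
  have [Sj|] := boolP (S j); last by exists ([::], 0).
  by have [A [c Ac]] := u_basis_span G2 fu f Sj; exists (A, c).
(* Indices in block [N] are at least [N], so [kappa] tends to infinity, and there the reductions to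
   [u_basis] hold exactly for all [j] up to [N]; a given [j] is covered from block [j] on. *)
pose W N : set nat := [set k | (N <= k)%N /\
  forall j : 'I_N.+1, S j -> f j k = \sum_(i <- (R j).1) f i k + (R j).2].
have uW N : u (W N).
  apply: filterI; first exact: utail.
  apply: filter_forall => j; have [Sj|nSj] := boolP (S j).
    by apply: filterS (RP j Sj).2 => k.
  by apply: filterS filterT => k _ Sj; case/negP: nSj.
have /choice[kap kapP] N := free_block G2 fu S f N (uW N).
pose kappa (x : nat * nat) := kap x.1 x.2.
have /choice[w wP] (jx : nat * (nat * nat)) :
    exists s : seq (gen K), f jx.1 (kappa jx.2) = \sum_(a <- s) b a.
  exact: b_span.
(* The basis sequences, expanded in generators on independent blocks, form a valid tuple whose
   formal limits yield limits of all the [f j]. *)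
pose T := Tuple (u_basis u S f) (fun j x => size (w (j, x)))
  (fun j x i => nth (Base i0 0) (w (j, x)) i).
have tvalT j x : tval b T j x = f j (kappa x).
  by rewrite /tval (wP (j, x)) (big_nth (Base i0 0)) big_mkord.
have vT : valid b T.
  split; first by move=> /card_le_trans KJ; apply: SK; apply: KJ;
    apply: subset_card_le => j /andP[].
  move=> N; have [_] := kapP N; rewrite /block_free => kfree c cJ c0.
  apply: kfree => //; rewrite -[RHS]c0; apply: eq_bigr => i _.
  by rewrite tvalT.
have [_ /(_ _ vT)[pTU fp] _] := p_coherent.
have ptail n : p T [set x | (n <= x.1)%N] by apply: fp; exact: block_filter_tail.
exists (p T), kappa, (fun j => \sum_(i <- (R j).1) b (tlim T i) + (R j).2); split=> //.
  move=> n; apply: filterS (ptail n) => -[N l] /= nN.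
  by have [/(_ l)[Nk _] _] := kapP N; exact: leq_trans Nk.
move=> chi [chiD chip] j Sj; have [RJ _] := RP j Sj.
have lim_sum : p T [set x | chi (\sum_(i <- (R j).1) f i (kappa x)) =
    chi (\sum_(i <- (R j).1) b (tlim T i))].
  elim: (R j).1 RJ => [_|i A IH AJ].
    by apply: filterS filterT => x _ /=; rewrite !big_nil.
  have {}IH := IH (fun k kA => AJ k (mem_behead (s := i :: A) kA)).
  have Ji : tJ T i by exact: AJ (mem_head _ _).
  apply: filterS2 (chip T vT i Ji) IH => x /= + E.
  by rewrite tvalT => Ei; rewrite !big_cons !chiD Ei E.
apply: filterS2 (ptail j) lim_sum => -[N l] /= jN E.
have [/(_ l)[_ kj] _] := kapP N; have jN1 : (j < N.+1)%N by [].
by rewrite (kj (Ordinal jN1) Sj) !chiD E.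
Qed.

End CommonLimit.

(** * The topology *)

Local Open Scope card_scope.

(** By transfinite recursion, each point is sent outside the countable set of values at smaller
    points. *)
Lemma omega1_le_uncountable (I : Type) : ~ countable [set: I] ->
  exists F : omega1 -> I, injective F.
Proof.
move=> nI; have [wo _ seg] := omega1P.
pose lt (w v : omega1) := omega1_le w v /\ w <> v.
have tot v w : v <> w -> lt v w \/ lt w v.
  move=> vw; have /orP[vw'|wv'] : omega1_le v w || omega1_le w v.
    exact: cantor_le_total.
  - by left.
  - by right; split=> // wv; apply: vw.
have wf : well_founded lt.
  move=> v; apply: contrapT => nAv.
  pose A : {pred omega1} := fun v => `[< ~ Acc lt v >].
  have [|m [[/asboolP Am mA] _]] := wo A; first by exists v; apply/asboolP.
  apply: Am; constructor => w [wm wNm]; apply: contrapT => nAw.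
  apply: wNm; apply: omega1_val_inj; apply: cantor_le_anti => //.
  by apply: mA; apply/asboolP.
have /choice[c cP] (Y : set I) : exists x, countable Y -> ~ Y x.
  have [cY|] := pselect (countable Y); last first.
    move=> ncY; have [x _] : exists x : I, True; last by exists x.
    apply: contrapT => nx; apply: nI; rewrite (_ : [set: I] = set0) //.
    by rewrite -subset0 => x _; apply: nx; exists x.
  have [x nYx] : exists x, ~ Y x; last by exists x.
  apply: contrapT => /forallNP YI; apply: nI.
  by rewrite (_ : [set: I] = Y) //; apply/seteqP; split=> // x _; apply: contrapT.
pose step v (rec : forall w, lt w v -> I) : I :=
  c [set x | exists w (h : lt w v), rec w h = x].
pose F := Fix wf (fun=> I) step.
have FE v : F v = c [set x | exists2 w, lt w v & F w = x].
  rewrite {1}/F Fix_eq.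
    congr c; apply/seteqP; split=> [x [w [h <-]]|x [w h <-]]; first by exists w.
    by exists w, h.
  move=> w f g fg; rewrite /step; congr c; apply/funext => x; apply/propext.
  by split=> -[w' [h <-]]; exists w', h.
have new v w : lt w v -> F w <> F v.
  move=> wv FwF; have : countable [set x | exists2 w, lt w v & F w = x].
    apply: (@sub_countable _ _ _ [set w | omega1_le w v]); last exact: seg.
    apply: (card_le_trans _ (card_image_le F [set w | omega1_le w v])).
    by apply: subset_card_le => x [w' [w'v _] <-]; exists w'.
  by move=> /cP; rewrite -FE; apply; exists w.
exists F => v w Fvw; apply: contrapT => /tot[/new|/new]; apply=> //.
Qed.

Lemma below_omega1_countable (K I : Type) : [set: K] #<= [set: omega1] ->
  card_lt I K -> exists e : I -> nat, injective e.
Proof.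
move=> K1 [_ nKI]; apply/card_le_setTP; apply: contrapT => nI; apply: nKI.
by apply: card_le_trans K1 _; apply/card_le_setTP; exact: omega1_le_uncountable.
Qed.

(** * The group topology induced by a family of characters *)

Structure character_family (G : zmodType) := CharacterFamily {
  family : set (G -> bool);
  family_character : forall chi, family chi -> character chi }.

Definition weak_group (G : zmodType) (X : character_family G) : Type := G.

Section WeakGroup.
Variables (G : zmodType) (X : character_family G).
Local Notation H := (weak_group X).

HB.instance Definition _ := GRing.Zmodule.copy H G.

Definition weak_nbhs (x : H) : set_system H :=
  [set A | exists2 s : seq (G -> bool), {in s, forall chi, family X chi} &
    forall y : H, {in s, forall chi, chi y = chi x} -> A y].

HB.instance Definition _ := hasNbhs.Build H weak_nbhs.

Lemma weak_nbhs_filter (x : H) : ProperFilter (nbhs x).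
Proof.
split; first by move=> [s sX] /(_ x); apply.
split.
- by exists [::].
- move=> A B [s sX sA] [t tX tB]; exists (s ++ t).
    by move=> chi; rewrite mem_cat => /orP[/sX|/tX].
  move=> y yE; split; [apply: sA|apply: tB] => chi chis; apply: yE.
    by rewrite mem_cat chis.
  by rewrite mem_cat chis orbT.
- by move=> A B AB [s sX sA]; exists s => // y /sA /AB.
Qed.

Lemma weak_nbhs_singleton (x : H) (A : set H) : nbhs x A -> A x.
Proof. by move=> [s sX]; apply. Qed.

Lemma weak_nbhs_nbhs (x : H) (A : set H) : nbhs x A -> nbhs x (nbhs^~ A).
Proof.
move=> [s sX sA]; exists s => // y yx; exists s => // z zy.
by apply: sA => chi chis; rewrite zy // yx.
Qed.

HB.instance Definition _ := Nbhs_isNbhsTopological.Build H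
  weak_nbhs_filter weak_nbhs_singleton weak_nbhs_nbhs.

Lemma weak_sub_continuous : continuous (fun x : H * H => x.1 - x.2).
Proof.
move=> [x y] A [s sX sA].
exists ([set z : H | {in s, forall chi, chi z = chi x}],
        [set z : H | {in s, forall chi, chi z = chi y}]).
  by split; exists s.
move=> [x' y'] [/= x's y's]; apply: sA => chi chis.
have chiD := family_character (sX _ chis).
have chiN z : chi (- z) = chi z.
  apply/eqP; rewrite -negb_add; apply/negPf.
  by rewrite -chiD addNr (character0 chiD).
by rewrite !chiD !chiN x's // y's.
Qed.

HB.instance Definition _ :=
  PreTopologicalNmodule_isTopologicalZmodule.Build H weak_sub_continuous.

Lemma nbhs_weak (x : H) chi : family X chi -> nbhs x [set y : H | chi y = chi x].
Proof.
move=> Xchi; exists [:: chi]; first by move=> ?; rewrite inE => /eqP ->.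
by move=> y; apply; rewrite inE.
Qed.

Lemma weak_hausdorff : (forall x, x <> 0 -> exists2 chi, family X chi & chi x) ->
  hausdorff_space H.
Proof.
move=> sep x y xy; apply: contrapT => xNy.
have [|chi Xchi chixy] := sep (x - y); first by move/eqP; rewrite subr_eq0 => /eqP.
have [z [/= zx zy]] := xy _ _ (nbhs_weak x Xchi) (nbhs_weak y Xchi).
have : chi (x - y + y) = chi (x - y) (+) chi y by exact: family_character Xchi _ _.
by rewrite subrK chixy -zx zy; case: (chi y).
Qed.

End WeakGroup.

Lemma weak_groupE (G : zmodType) (X : character_family G) :
  (weak_group X : topologicalZmodType) = G :> zmodType.
Proof. by case: G X => T [] *. Qed.

(** * Accumulation points in powers *)

Section WeakPowers.
Variables (G : zmodType) (X : character_family G) (I : Type).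
Local Notation H := (weak_group X).

(** Convergence along [P] is checked coordinate by coordinate; as [kappa] tends to infinity along
    [P], no neighbourhood of [y] is visited only finitely often. *)
Lemma power_accumulation (D : Type) (P : set_system D) (kappa : D -> nat)
    (u : nat -> {ptws I -> H}) (y : {ptws I -> H}) :
  UltraFilter P -> (forall n, P [set x | (n <= kappa x)%N]) ->
  (forall chi i, family X chi -> P [set x | chi (u (kappa x) i) = chi (y i)]) ->
  accumulation_point u y.
Proof.
move=> PU Ptail Plim.
have Pnear i (A : set H) : nbhs (y i) A -> P [set x | A (u (kappa x) i)].
  move=> [s sX sA].
  suff : P [set x | {in s, forall chi, chi (u (kappa x) i) = chi (y i)}].
    by apply: filterS => x xs; exact: sA.
  elim: s sX {sA} => [_|chi s IH sX]; first by apply: filterS filterT => x _ chi.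
  have {}IH := IH (fun c cs => sX c (mem_behead (s := chi :: s) cs)).
  apply: filterS2 (Plim chi i (sX chi (mem_head _ _))) IH => x xchi xs c.
  by rewrite inE => /predU1P[->|/xs].
have Pcvg : (u \o kappa) @ P --> y.
  apply/cvg_sup => i U [V] [[W] oW <-] Wy WU.
  apply: (filterS WU); apply: (Pnear i); exact: open_nbhs_nbhs.
move=> U /Pcvg PU' Ufin.
have /finite_seqP[s Us] := Ufin.
have [x /= Ux] := ultra_meet PU PU' (Ptail (\max_(n <- s) n).+1).
have : [set n | U (u n)] (kappa x) by [].
by rewrite Us /= => ks; rewrite ltnNge (leq_bigmax_seq _ ks isT).
Qed.

(** The tails and the sets of times spent in neighbourhoods of [y] generate a proper filter; an
    ultrafilter above it has these limits. *)
Lemma accumulation_ultrafilter (u : nat -> {ptws I -> H}) (y : {ptws I -> H}) :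
  accumulation_point u y ->
  exists2 q, free_ultrafilter q &
    forall chi i, family X chi -> q [set k | chi (u k i) = chi (y i)].
Proof.
move=> uy.
pose F : set_system nat := [set A | exists2 U : set {ptws I -> H}, nbhs y U &
  exists m, forall n, (m <= n)%N -> U (u n) -> A n].
have F_filter : ProperFilter F.
  split.
    move=> [U /uy Uinf [m mU]]; apply: Uinf.
    apply: (@sub_finite_set _ _ `I_m); last exact: finite_II.
    by move=> n Un /=; rewrite ltnNge; apply/negP => /mU; apply.
  split.
  - by exists setT; [exact: filterT|exists 0%N].
  - move=> A B [U yU [m mU]] [V yV [n nV]]; exists (U `&` V); first exact: filterI.
    exists (maxn m n) => k; rewrite geq_max => /andP[mk nk] [Uk Vk].
    by split; [exact: mU|exact: nV].
  - by move=> A B AB [U yU [m mU]]; exists U => //; exists m => n mn /(mU n mn)/AB.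
have [q [qU Fq]] := ultraFilterLemma F_filter.
exists q.
  split=> // n; apply: Fq; exists setT; first exact: filterT.
  by exists n.
move=> chi i Xchi; apply: Fq.
exists [set h : {ptws I -> H} | chi (h i) = chi (y i)]; last by exists 0%N.
have /cvg_sup/(_ i) : nbhs y --> (y : {ptws I -> H}) by exact: cvg_id.
have := nbhs_weak (y i) Xchi; rewrite [X in X _ -> _]nbhsE => -[B [oB Byi] BA].
apply.
exists (@^~ i @^-1` B); split=> //; first by exists B.
by move=> h; exact: BA.
Qed.

End WeakPowers.

Theorem mainTheorem5 (K : Type)
    (K_ge1 : [set: unit] #<= [set: K]) (K_le : [set: K] #<= [set: omega1])
    (G : zmodType) (G_boolean : boolean_group G)
    (G_card : [set: G] #= [set: nat -> bool]) :
  exists H : topologicalZmodType,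
    [/\ (H : zmodType) = G,
        hausdorff_space H,
        forall I : Type, card_lt I K -> countably_compact {ptws I -> H} &
        ~ countably_compact {ptws K -> H}].
Proof.
have [k0 _] := (card_le_setTP unit K).1 K_ge1; set i0 := k0 tt.
have K_continuum : le_continuum K.
  have [f finj] := (card_le_setTP K omega1).1 K_le.
  by apply: (le_continuum_inj finj); exists sval; exact: omega1_val_inj.
have G_continuum : le_continuum G.
  by have /card_eqPle[/card_le_setTP] := G_card.
have [b [b_span b_free]] :=
  free_basis G_boolean G_card (gen_continuum i0 K_continuum).
have [p [p_coherent p_prevents]] :=
  @complete_assignment K i0 G G_boolean b b_span b_free K_continuum G_continuum.
pose X := @CharacterFamily G (chars b (valid b) p) (fun chi chiP => chiP.1).
have separate x : x <> 0 -> exists2 chi, chars b (valid b) p chi & chi x.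
  have [_ pU _] := p_coherent.
  exact: (@chars_separate K i0 G G_boolean b b_span b_free K_continuum p (valid b)).
exists (weak_group X); split.
- exact: weak_groupE.
- by apply: weak_hausdorff => x x0; exact: separate.
(* The exponent [I] is countable, so [e] turns the coordinates of [u] into sequences indexed by a
   set [S] of naturals, to which [common_limit] applies. *)
- move=> I IK u; have [e einj] := below_omega1_countable K_le IK.
  pose S j := `[< exists i, e i = j >].
  have SK : ~ ([set: K] #<= [set j | S j]).
    move=> KS; apply: IK.2; apply: (card_le_trans KS).
    apply: card_le_trans (card_image_le e [set: I]).
    by apply: subset_card_le => j /asboolP[i <-]; exists i.
  have /choice[g gP] (j : nat) : exists g : nat -> G, forall i, e i = j -> g = u^~ i.
    have [[i ij]|ni] := pselect (exists i, e i = j).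
      by exists (u^~ i) => i' i'j; have -> : i = i' by apply: einj; rewrite ij i'j.
    by exists (fun=> 0) => i ij; case: ni; exists i.
  have [P [kappa [y [PU Ptail Plim]]]] :=
    @common_limit K i0 G G_boolean b b_span K_continuum p p_coherent S g SK.
  exists (y \o e); apply: (power_accumulation (X := X) PU Ptail) => chi i chiP.
  have Sei : S (e i) by apply/asboolP; exists i.
  by apply: filterS (Plim chi chiP _ Sei) => x /=; rewrite (gP _ i erefl).
(* The [i]-th coordinate is the [i]-th base sequence. An accumulation point would give a free [q]
   along which all of them converge, and its coordinates are known to [valid], as every element of
   [G] is. *)
- move=> /(_ (fun k i => b (Base i k)))[y /accumulation_ultrafilter[q fq qlimy]].
  have [i /(_ (y i))qi] := p_prevents q fq.
  apply: qi.
    have [s ->] := b_span (y i).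
    by apply: known_span_sum => g _; apply: known_span_gen => vg.
  move=> chi chiP; have [qU _] := fq.
  by apply: filterS (qlimy chi i chiP) => k /=; rewrite /base_sum big_seq1.
Qed.
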